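(* Let $\dot A$ be a symmetric densely defined closed operator with deficiency indices $(1,1)$ in a Hilbert space $\mathcal H$ and let $g_\pm\in\operatorname{Ker}(\dot A^*\mp iI)$ be $(+)$-normalized deficiency vectors, $\|g_\pm\|_+=1$. Assume that $A$ is a self-adjoint extension of $\dot A$ such that $g_++g_-\in\mathrm{Dom}(A)$, and let $M_{(\dot A,A)}(z)$ denote the Weyl-Titchmarsh function of the pair $(\dot A,A)$. Then for any $a>1$ the function $aM_{(\dot A,A)}(z)$ can be represented as the impedance function of an L-system of the form $$\Theta_{1a}=\begin{pmatrix}\mathbb A_{1a}&K_{1a}&1\\ \mathcal H_+\subset\mathcal H\subset\mathcal H_-&&\mathbb C\end{pmatrix},$$ $$\mathbb A_{1a}=\dot A^*-\tfrac i2\big(\cdot,(1-a)\varphi-(1+a)\psi\big)(\varphi+\psi),\quad K_{1a}c=c\cdot\sqrt{\tfrac a2}\,(\varphi+\psi)\ (c\in\mathbb C),$$ where $\varphi=\mathcal R^{-1}g_+$, $\psi=\mathcal R^{-1}g_-$, with c-entropy $\mathcal S$ and coefficient of dissipation $\mathcal D$ of the main operator of $\Theta_{1a}$ given by $$\mathcal S=\ln(a+1)-\ln(a-1)\quad\text{and}\quad\mathcal D=\frac{4a}{(1+a)^2},$$ respectively. Moreover, if $\Theta$ is an L-system with state-space operator $\mathbb A$ and symmetric operator $\dot A$ such that $V_\Theta(z)=aM_{(\dot A,A)}(z)$ for $z\in\mathbb C_+$, where $A=\hat A$ is the quasi-kernel of $\mathrm{Re}\,\mathbb A$, then $\Theta$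 has c-entropy $\mathcal S=\ln(a+1)-\ln(a-1)$ and coefficient of dissipation of the main operator $\mathcal D=\frac{4a}{(1+a)^2}$.
   Context: Inner products are linear in the first argument. $\mathbb C_\pm$ are the open upper and lower half-planes. Rigged space. For a closed densely defined symmetric $\dot A$ in $\mathcal H$, $\mathcal H_+=\mathrm{Dom}(\dot A^* )$ with $(f,g)_+=(f,g)+(\dot A^*f,\dot A^*g)$, and $\mathcal H_-$ is the corresponding negative space (dual of $\mathcal H_+$ with respect to the pairing extending the inner product of $\mathcal H$, also written $(\cdot,\cdot)$), so $\mathcal H_+\subset\mathcal H\subset\mathcal H_-$. The Riesz-Berezansky operator $\mathcal R$ is the isometric (linear) map of $\mathcal H_-$ onto $\mathcal H_+$ with $(f,g)=(f,\mathcal Rg)_+$ for $f\in\mathcal H_+$, $g\in\mathcal H_-$. $[\mathcal H_1,\mathcal H_2]$ denotes bounded linear operators. For $\mathbb A\in[\mathcal H_+,\mathcal H_-]$ the adjoint $\mathbb A^*\in[\mathcal H_+,\mathcal H_-]$ is taken with respect to the pairing; $\mathrm{Re}\,\mathbb A=\frac12(\mathbb A+\mathbb A^* )$, $\mathrm{Im}\,\mathbb A=\frac1{2i}(\mathbb A-\mathbb A^* )$. For $u,v\in\mathcal H_-$, $(\cdot,u)v$ denotes the operator $f\mapsto(f,u)v$ from $\mathcal H_+$ to $\mathcal H_-$. Extensions. A quasi-self-adjoint extension of $\dot A$ is a non-symmetric operator $T$ in $\mathcal H$ with $\dot A\subset T\subset\dot A^*$. A self-adjoint bi-extension of $\dot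 A$ is $\mathbb B\in[\mathcal H_+,\mathcal H_-]$ with $\dot A\subset\mathbb B=\mathbb B^*$; its quasi-kernel is the restriction of $\mathbb B$ to $\{f\in\mathcal H_+:\mathbb Bf\in\mathcal H\}$; it is t-self-adjoint if its quasi-kernel is self-adjoint in $\mathcal H$. If $T$ is a quasi-self-adjoint extension of $\dot A$ with $\rho(T)\neq\emptyset$, a $( * )$-extension of $T$ is $\mathbb A\in[\mathcal H_+,\mathcal H_-]$ with $\mathbb A\supset T\supset\dot A$, $\mathbb A^*\supset T^*\supset\dot A$ and $\mathrm{Re}\,\mathbb A$ a t-self-adjoint bi-extension of $\dot A$. L-system. An array $\Theta=\begin{pmatrix}\mathbb A&K&1\\ \mathcal H_+\subset\mathcal H\subset\mathcal H_-&&\mathbb C\end{pmatrix}$ is an L-system if (1) $T$ is a dissipative ($\mathrm{Im}(Tf,f)\ge0$, $f\in\mathrm{Dom}(T)$) quasi-self-adjoint extension, with $\rho(T)\ne\emptyset$, of a symmetric operator $\dot A$ with deficiency indices $(1,1)$; (2) $\mathbb A$ is a $( * )$-extension of $T$; (3) $\mathrm{Im}\,\mathbb A=KK^*$ with $K\in[\mathbb C,\mathcal H_-]$, $K^*\in[\mathcal H_+,\mathbb C]$. Here $\dot A$, $T$, $\mathbb A$, $K$ are the symmetric, main, state-space and channel operators. The transfer function is $W_\Theta(z)=I-2iK^*(\mathbb A-zI)^{-1}K$, $z\in\rho(T)$, and the impedance function is $V_\Theta(z)=K^*(\mathrm{Re}\,\mathbb A-zI)^{-1}K$ for nonreal $z\in\rho(T)$,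 extended analytically to all of $\mathbb C_\pm$. Weyl-Titchmarsh function: for a self-adjoint extension $A$ of $\dot A$, $M_{(\dot A,A)}(z)=((Az+I)(A-zI)^{-1}g,g)$, $z\in\mathbb C_+$, where $g\in\operatorname{Ker}(\dot A^*-iI)$ has $\|g\|=1$ in the norm of $\mathcal H$ (e.g. $g=\sqrt2\,g_+$ for $(+)$-normalized $g_+$). c-entropy: $\mathcal S=-\ln(|W_\Theta(-i)|)$, with $\mathcal S=\infty$ if $W_\Theta(-i)=0$. Coefficient of dissipation: let $g'_\pm=\sqrt2\,g_\pm$, so $\|g'_\pm\|=1$ in $\mathcal H$, and let $\kappa$ be the von Neumann parameter of $T$, i.e. the number $|\kappa|<1$ with $g'_+-\kappa g'_-\in\mathrm{Dom}(T)$ (in the definition it is required that the basis is such that $0\le\kappa\le1$). With $\tilde y=g'_+-\kappa g'_-$, $\mathcal D=\mathrm{Im}(T\tilde y,\tilde y)$. *)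

(* Defs.v *)
From HB Require Import structures.
From mathcomp Require Import all_boot all_order all_algebra.
From mathcomp Require Import complex ring.
From mathcomp Require Import all_classical all_reals all_analysis.

Set Implicit Arguments.
Unset Strict Implicit.
Unset Printing Implicit Defensive.

Import Order.TTheory GRing.Theory Num.Theory numFieldNormedType.Exports.

Local Open Scope classical_set_scope.
Local Open Scope complex_scope.
Local Open Scope ring_scope.

(* Complex Hilbert spaces, with the inner product linear in the first
   argument. *)
HB.mixin Record NormedModule_isHilbert (R : realType) H
    & CompleteNormedModule R[i] H := {
  dot : H -> H -> R[i];
  dot_linearl : forall v, linear (dot^~ v : H -> R[i]^o);
  dotC : forall u v, dot v u = (dot u v)^*;
  dot_norm : forall u, dot u u = `|u| ^+ 2
}.

#[short(type="hilbertType")]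
HB.structure Definition Hilbert (R : realType) :=
  {H of NormedModule_isHilbert R H & CompleteNormedModule R[i] H}.

Section Hermitian.
Variables (R : realType) (V : lmodType R[i]) (b : V -> V -> R[i]).
Hypothesis b_lin : forall v, linear (b^~ v : V -> R[i]^o).
Hypothesis bC : forall u v, b v u = (b u v)^*.
Hypothesis b_ge0 : forall u, 0 <= b u u.
Hypothesis b_eq0 : forall u, b u u = 0 -> u = 0.

Lemma formDl u v w : b (u + v) w = b u w + b v w.
Proof. by have := b_lin w 1 u v; rewrite !scale1r. Qed.

Lemma form0l w : b 0 w = 0.
Proof. by apply: (addIr (b 0 w)); rewrite -formDl !add0r. Qed.

Lemma formZl c u w : b (c *: u) w = c * b u w.
Proof. by have := b_lin w c u 0; rewrite !addr0 form0l addr0. Qed.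

Lemma formDr u v w : b u (v + w) = b u v + b u w.
Proof. by rewrite bC formDl rmorphD /= -!bC. Qed.

Lemma formZr c u w : b u (c *: w) = c^* * b u w.
Proof. by rewrite bC formZl rmorphM /= -bC. Qed.

Lemma form0r w : b w 0 = 0.
Proof. by rewrite bC form0l rmorph0. Qed.

Lemma form_CS u v : `|b u v| ^+ 2 <= b u u * b v v.
Proof.
have [v0|v0] := eqVneq (b v v) 0.
  by rewrite (b_eq0 v0) !form0r normr0 expr0n /= mulr0.
have v_gt0 : 0 < b v v by rewrite lt_def v0 b_ge0.
have := b_ge0 (b v v *: u + (- b u v) *: v).
rewrite !(formDl, formDr, formZl, formZr) !rmorphN /= (bC u v).
rewrite (geC0_conj (b_ge0 v)).
set x := b u v; set y := x^*; set p := b v v; set q := b u u => h.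
have : 0 <= p * (q * p - x * y) by apply: le_trans h _; rewrite le_eqVlt; apply/orP; left; apply/eqP; ring.
by rewrite pmulr_rge0 // subr_ge0 normCK.
Qed.

Lemma form_CS1 u v : `|b u v| <= sqrtC (b u u) * sqrtC (b v v).
Proof.
rewrite -(@ler_pXn2r _ 2) ?nnegrE ?mulr_ge0 ?sqrtC_ge0 //.
by rewrite exprMn !sqrtCK form_CS.
Qed.

Lemma form_normD u v :
  sqrtC (b (u + v) (u + v)) <= sqrtC (b u u) + sqrtC (b v v).
Proof.
rewrite -(@ler_pXn2r _ 2) ?nnegrE ?addr_ge0 ?sqrtC_ge0 //.
rewrite sqrrD !sqrtCK formDl !formDr (bC u v).
have -> : b u u + b u v + ((b u v)^* + b v v)
  = b u u + (b u v + (b u v)^*) + b v v by rewrite !addrA.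
rewrite lerD2r lerD2l.
have h : b u v + (b u v)^* = 'Re (b u v) *+ 2.
  by rewrite ReE -mulr_natr mulfVK // pnatr_eq0.
rewrite h lerMn2r /=; apply: le_trans (form_CS1 u v).
by have /leifP := leif_Re_Creal (b u v); case: ifP => _ => [/eqP->|/ltW].
Qed.

Lemma form_normZ c u : sqrtC (b (c *: u) (c *: u)) = `|c| * sqrtC (b u u).
Proof.
rewrite formZl formZr mulrA -normCK rootCMl ?exprn_ge0 ?normr_ge0 //.
by rewrite sqrCK.
Qed.
End Hermitian.

Section Operators.
Variables (R : realType) (H : hilbertType R).

Lemma dot_ge0 (u : H) : 0 <= dot u u.
Proof. by rewrite dot_norm exprn_ge0. Qed.

Lemma dot_eq0 (u : H) : dot u u = 0 -> u = 0.
Proof. by rewrite dot_norm => /eqP; rewrite expf_eq0 /= normr_eq0 => /eqP. Qed.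

Lemma sqrtC_dot (u : H) : sqrtC (dot u u) = `|u|.
Proof. by rewrite dot_norm sqrCK. Qed.

Lemma dot_CS (u v : H) : `|dot u v| <= `|u| * `|v|.
Proof.
rewrite -!sqrtC_dot.
exact: form_CS1 (@dot_linearl R H) (@dotC R H) dot_ge0 dot_eq0 u v.
Qed.

(* An unbounded operator is represented by its graph, so that the inclusion of
   sets is the extension order on operators. *)
Definition operator (S : set (H * H)) :=
  [/\ S 0, forall c p q, S p -> S q -> S (c *: p + q)
    & forall f u v, S (f, u) -> S (f, v) -> u = v].

Definition dom (S : set (H * H)) : set H := [set f | exists h, S (f, h)].

(* The value of S at f; it is meaningful only for f in dom S. *)
Definition app (S : set (H * H)) (f : H) : H := xget 0 [set h | S (f, h)].

Definition adj (S : set (H * H)) : set (H * H) :=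
  [set p | forall q, S q -> dot q.2 p.1 = dot q.1 p.2].

Definition symmetric_operator (S : set (H * H)) := S `<=` adj S.

Definition self_adjoint (S : set (H * H)) := operator S /\ adj S = S.

(* The bounded everywhere defined inverse of S - z exists. *)
Definition resolvent_set (S : set (H * H)) : set R[i] :=
  [set z | (forall h, exists! f, S (f, h + z *: f)) /\
    exists M : R[i], forall f w, S (f, w) -> `|f| <= M * `|w - z *: f|].

(* (S - z)^-1 h, for z in the resolvent set of S. *)
Definition resolvent (S : set (H * H)) (z : R[i]) (h : H) : H :=
  xget 0 [set f | S (f, h + z *: f)].

Record symop := SymOp {
  symop_graph :> set (H * H);
  symop_operator : operator symop_graph;
  symop_dense : dense (dom symop_graph);
  symop_closed : closed symop_graph;
  symop_symmetric : symmetric_operator symop_graph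
}.

Definition has_dim (V : set H) (n : nat) :=
  exists2 e : 'I_n -> H,
    (forall c : 'I_n -> R[i], \sum_i c i *: e i = 0 -> forall i, c i = 0) &
    V = [set f | exists c : 'I_n -> R[i], f = \sum_i c i *: e i].

(* Ker (A^* - z) *)
Definition defect (A : symop) (z : R[i]) : set H :=
  [set f | adj A (f, z *: f)].

Definition deficiency_indices (A : symop) (m n : nat) :=
  has_dim (defect A 'i) m /\ has_dim (defect A (- 'i)) n.

Definition self_adjoint_extension (A : symop) (S : set (H * H)) :=
  A `<=` S /\ self_adjoint S.

Definition quasi_self_adjoint_extension (A : symop) (T : set (H * H)) :=
  [/\ operator T, ~ symmetric_operator T, A `<=` T & T `<=` adj A].

Definition dissipative (T : set (H * H)) :=
  forall f w, T (f, w) -> 0 <= complex.Im (dot w f).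

(* ((S z + I) (S - z)^-1 g, g), where g is to be a unit vector in the kernel of
   A^* - i and S a self-adjoint extension of A. *)
Definition weyl_titchmarsh (S : set (H * H)) (g : H) (z : R[i]) : R[i] :=
  let x := resolvent S z g in dot (z *: app S x + x) g.

Lemma adj_linear (S : set (H * H)) c p q :
  adj S p -> adj S q -> adj S (c *: p + q).
Proof.
move=> Sp Sq r Sr /=.
by rewrite !(formDr (@dot_linearl R H) (@dotC R H),
  formZr (@dot_linearl R H) (@dotC R H)) Sp // Sq.
Qed.

Lemma adj0 (S : set (H * H)) : adj S 0.
Proof. by move=> r _ /=; rewrite !(form0r (@dot_linearl R H) (@dotC R H)). Qed.

Lemma dense_orth (D : set H) (w : H) :
  dense D -> (forall x, D x -> dot x w = 0) -> w = 0.
Proof.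
move=> dD Dw; apply/eqP/negPn/negP => w0.
have e0 : 0 < `|w| by rewrite normr_gt0.
have [|x [xw Dx]] := dD _ _ (@open_interior _ (ball w `|w|)).
  by exists w; exact: nbhsx_ballx.
have {}xw : `|w - x| < `|w|.
  by have := interior_subset xw; rewrite -ball_normE.
have := dot_CS (w - x) w.
rewrite (formDl (@dot_linearl R H)) -scaleN1r (formZl (@dot_linearl R H)).
rewrite (Dw x) // mulr0 addr0 dot_norm normrX normr_id expr2.
by rewrite ler_pM2r // scaleN1r => /le_lt_trans /(_ xw); rewrite ltxx.
Qed.

Lemma adj_fun (A : symop) f u v : adj A (f, u) -> adj A (f, v) -> u = v.
Proof.
move=> Au Av; apply/eqP; rewrite -subr_eq0; apply/eqP.
apply: (dense_orth (symop_dense A)) => x [y Axy].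
rewrite (formDr (@dot_linearl R H) (@dotC R H)) -scaleN1r.
rewrite (formZr (@dot_linearl R H) (@dotC R H)).
by rewrite -(Au _ Axy) -(Av _ Axy) /= rmorphN1 mulN1r subrr.
Qed.

Lemma appP (S : set (H * H)) f : dom S f -> S (f, app S f).
Proof. by move=> [h Sh]; rewrite /app; case: xgetP => [y _ //|/(_ h)]. Qed.

End Operators.

Section Plus.
Variables (R : realType) (H : hilbertType R) (A : symop H).

Definition dom_adj : {pred H} := [pred f | f \in dom (adj A)].

Record Hplus := HPlus { hp_val :> H; hp_mem : hp_val \in dom_adj }.

HB.instance Definition _ := [isSub for hp_val].
HB.instance Definition _ := [Choice of Hplus by <:].

Lemma dom_adj_submod : submod_closed dom_adj.
Proof.
split; first by apply/mem_set; exists 0; exact: adj0.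
move=> c f g /set_mem[u Au] /set_mem[v Av]; apply/mem_set; exists (c *: u + v).
exact: (adj_linear c Au Av).
Qed.

HB.instance Definition _ := GRing.isSubmodClosed.Build _ _ dom_adj
  dom_adj_submod.
HB.instance Definition _ := [SubChoice_isSubLmodule of Hplus by <:].

Definition Astar (f : Hplus) : H := app (adj A) (val f).

Lemma AstarP (f : Hplus) : adj A (val f, Astar f).
Proof. by apply: appP; exact/set_mem/(valP f). Qed.

Lemma Astar_linear : linear Astar.
Proof.
move=> c f g; apply: (adj_fun (AstarP _)).
exact: (adj_linear c (AstarP f) (AstarP g)).
Qed.

Definition dotp (f g : Hplus) : R[i] :=
  dot (val f) (val g) + dot (Astar f) (Astar g).

Lemma dotp_linearl g : linear (dotp^~ g : Hplus -> R[i]^o).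
Proof.
move=> c u v; rewrite /dotp Astar_linear linearP /=.
rewrite !(formDl (@dot_linearl R H), formZl (@dot_linearl R H)).
by rewrite scalerDr addrACA.
Qed.

Lemma dotpC f g : dotp g f = (dotp f g)^*.
Proof. by rewrite /dotp rmorphD /= -!dotC. Qed.

Lemma dotp_ge0 f : 0 <= dotp f f.
Proof. by rewrite addr_ge0 ?dot_ge0. Qed.

Lemma dotp_eq0 f : dotp f f = 0 -> f = 0.
Proof.
move/eqP; rewrite paddr_eq0 ?dot_ge0 // => /andP[/eqP/dot_eq0 f0 _].
exact/val_inj.
Qed.

Definition normp (f : Hplus) : R[i] := sqrtC (dotp f f).

Lemma normp_eq0 f : normp f = 0 -> f = 0.
Proof. by move/eqP; rewrite sqrtC_eq0 => /eqP/dotp_eq0. Qed.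

HB.instance Definition _ := Lmodule_isNormed.Build R[i] Hplus
  (form_normD dotp_linearl dotpC dotp_ge0 dotp_eq0)
  (form_normZ dotp_linearl dotpC)
  normp_eq0.

Lemma hplus_normE (f : Hplus) : `|f| = normp f.
Proof. by []. Qed.

Lemma dotp_CS f g : `|dotp f g| <= `|f| * `|g|.
Proof. exact: form_CS1 dotp_linearl dotpC dotp_ge0 dotp_eq0 f g. Qed.

Lemma norm_le_plus (f : Hplus) : `|val f| <= `|f|.
Proof.
rewrite hplus_normE -sqrtC_dot ler_sqrtC ?nnegrE ?dot_ge0 ?dotp_ge0 //.
by rewrite lerDl dot_ge0.
Qed.

Lemma norm_Astar_le (f : Hplus) : `|Astar f| <= `|f|.
Proof.
rewrite hplus_normE -sqrtC_dot ler_sqrtC ?nnegrE ?dot_ge0 ?dotp_ge0 //.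
by rewrite lerDr dot_ge0.
Qed.

(* The elements of H_- are the bounded antilinear functionals on H_+; phi f
   stands for (phi, f), so that H is embedded linearly, by h |-> (h, .). *)
Definition antilinear_bounded : {pred Hplus -> R[i]^o} :=
  mem [set phi : Hplus -> R[i]^o |
    (forall c f g, phi (c *: f + g) = c^* * phi f + phi g) /\
    exists M : R[i], forall f, `|phi f : R[i]| <= M * `|f|].

Record Hminus := HMinus {
  hm_fun :> Hplus -> R[i]^o;
  hm_mem : hm_fun \in antilinear_bounded
}.

HB.instance Definition _ := [isSub for hm_fun].
HB.instance Definition _ := [Choice of Hminus by <:].

Lemma antilinear_bounded_submod : submod_closed antilinear_bounded.
Proof.
split.
  have E f : (0 : Hplus -> R[i]^o) f = 0 by [].
  apply/mem_set; split; first by move=> c f g; rewrite !E mulr0 addr0.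
  by exists 0 => f; rewrite E mul0r normr0.
move=> c u v /set_mem[lu [M uM]] /set_mem[lv [N vN]]; apply/mem_set; split.
  move=> d f g; rewrite !fctE lu lv !scalerDr mulrDr addrACA; congr (_ + _).
  by congr (_ + _); rewrite /GRing.scale /= !mulrA (mulrC c).
exists (`|c| * M + N) => f; rewrite !fctE mulrDl.
apply: le_trans (ler_normD _ _) _; rewrite lerD //.
rewrite -[c *: u f]/(c * u f : R[i]) normrM -mulrA.
by rewrite ler_wpM2l.
Qed.

HB.instance Definition _ := GRing.isSubmodClosed.Build _ _ antilinear_bounded
  antilinear_bounded_submod.
HB.instance Definition _ := [SubChoice_isSubLmodule of Hminus by <:].

Lemma hminus_antilinear (phi : Hminus) c f g :
  phi (c *: f + g) = c^* * phi f + phi g.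
Proof. by have /set_mem[-> _] := valP phi. Qed.

Lemma hminus_bounded (phi : Hminus) :
  exists M : R[i], forall f, `|phi f : R[i]| <= M * `|f|.
Proof. by have /set_mem[_ ?] := valP phi. Qed.

Lemma hminusD (phi psi : Hminus) f : (phi + psi) f = phi f + psi f.
Proof. by []. Qed.

Lemma hminusZ c (phi : Hminus) f : (c *: phi) f = c * phi f.
Proof. by []. Qed.

Lemma hminusDr (phi : Hminus) f g : phi (f + g) = phi f + phi g.
Proof. by have := hminus_antilinear phi 1 f g; rewrite scale1r rmorph1 mul1r. Qed.

Lemma hminus0 (phi : Hminus) : phi 0 = 0.
Proof. by apply: (addIr (phi 0)); rewrite -hminusDr !add0r. Qed.

Lemma hminusZr (phi : Hminus) c f : phi (c *: f) = c^* * phi f.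
Proof. by have := hminus_antilinear phi c f 0; rewrite hminus0 !addr0. Qed.

(* The operator norm of phi, which is the norm of H_-. *)
Definition normm (phi : Hminus) : R :=
  sup [set complex.Re `|phi f : R[i]| | f in [set f : Hplus | `|f| <= 1]].

Lemma re_normE (x : R[i]) : (complex.Re `|x|)%:C = `|x|.
Proof. exact/RRe_real/normr_real. Qed.

Lemma normm_has_sup (phi : Hminus) :
  has_sup [set complex.Re `|phi f : R[i]| | f in [set f : Hplus | `|f| <= 1]].
Proof.
split; first by exists (complex.Re `|phi 0 : R[i]|); exists 0; rewrite //= normr0.
have [M phiM] := hminus_bounded phi.
exists (complex.Re `|M|) => _ [f /= f1 <-]; rewrite -lecR !re_normE.
apply: le_trans (phiM f) _; apply: le_trans (_ : `|M| * `|f| <= _); last first.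
  by rewrite ler_piMr.
rewrite -[in leRHS](normr_id f) -normrM; apply: real_ler_norm.
exact: ger0_real (le_trans _ (phiM f)).
Qed.

Lemma normm_ge0 (phi : Hminus) : 0 <= normm phi.
Proof.
apply: le_trans (_ : complex.Re `|phi 0 : R[i]| <= _).
  by rewrite -lecR re_normE normr_ge0.
by apply: (sup_upper_bound (normm_has_sup phi)); exists 0; rewrite //= normr0.
Qed.

Lemma normm_lub (phi : Hminus) (r : R) :
  (forall f : Hplus, `|f| <= 1 -> `|phi f : R[i]| <= r%:C) -> normm phi <= r.
Proof.
move=> phir; apply: ge_sup; first by have [] := normm_has_sup phi.
by move=> _ [f /= /phir f1 <-]; rewrite -lecR re_normE.
Qed.

Lemma normm_le (phi : Hminus) f :
  `|phi f : R[i]| <= (normm phi)%:C * `|f|.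
Proof.
have [->|f0] := eqVneq f 0; first by rewrite hminus0 !normr0 mulr0.
have e0 : 0 < `|f| by rewrite normr_gt0.
have : `|phi (`|f|^-1 *: f) : R[i]| <= (normm phi)%:C.
  rewrite -re_normE lecR; apply: (sup_upper_bound (normm_has_sup phi)).
  exists (`|f|^-1 *: f) => //=.
  by rewrite normrZ normfV normr_id mulVf ?gt_eqF.
rewrite hminusZr normrM norm_conjC normfV normr_id mulrC.
by rewrite ler_pdivrMr.
Qed.

Lemma normmD (phi psi : Hminus) :
  (normm (phi + psi))%:C <= (normm phi)%:C + (normm psi)%:C.
Proof.
rewrite -rmorphD /= lecR; apply: normm_lub => f f1.
rewrite hminusD; apply: le_trans (ler_normD _ _) _; rewrite rmorphD /= lerD //.
  by apply: le_trans (normm_le _ _) _; rewrite ler_piMr // lecR normm_ge0.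
by apply: le_trans (normm_le _ _) _; rewrite ler_piMr // lecR normm_ge0.
Qed.

Lemma normmZ_le (c : R[i]) (phi : Hminus) :
  (normm (c *: phi))%:C <= `|c| * (normm phi)%:C.
Proof.
rewrite -re_normE -rmorphM lecR; apply: normm_lub => f f1.
rewrite hminusZ normrM rmorphM /= re_normE ler_wpM2l //.
by apply: le_trans (normm_le _ _) _; rewrite ler_piMr // lecR normm_ge0.
Qed.

Lemma normmZ (c : R[i]) (phi : Hminus) :
  (normm (c *: phi))%:C = `|c| * (normm phi)%:C.
Proof.
apply/eqP; rewrite eq_le normmZ_le /=.
have [->|c0] := eqVneq c 0; first by rewrite normr0 mul0r lecR normm_ge0.
have := normmZ_le c^-1 (c *: phi).
rewrite scalerA mulVf // scale1r normfV => h.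
by rewrite -ler_pdivlMl ?normr_gt0.
Qed.

Lemma normm_eq0 (phi : Hminus) : (normm phi)%:C = 0 -> phi = 0.
Proof.
move=> p0; apply/val_inj/funext => f /=; apply/eqP.
by rewrite -normr_le0; apply: le_trans (normm_le phi f) _; rewrite p0 mul0r.
Qed.

HB.instance Definition _ := Lmodule_isNormed.Build R[i] Hminus
  normmD normmZ normm_eq0.

Lemma hminus_norm_le (phi : Hminus) f : `|phi f : R[i]| <= `|phi| * `|f|.
Proof. exact: normm_le. Qed.

Definition pairing (f : Hplus) (phi : Hminus) : R[i] := (phi f)^*.

Lemma emb_subproof (h : H) :
  (fun f : Hplus => dot h (val f) : R[i]^o) \in antilinear_bounded.
Proof.
apply/mem_set; split.
  move=> c f g; rewrite linearP (formDr (@dot_linearl R H) (@dotC R H)).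
  by rewrite (formZr (@dot_linearl R H) (@dotC R H)).
exists `|h| => f; apply: le_trans (_ : `|h| * `|val f| <= _).
  exact: dot_CS.
by rewrite ler_wpM2l // norm_le_plus.
Qed.

(* The inclusion of H in H_-. *)
Definition emb (h : H) : Hminus := HMinus (emb_subproof h).

(* The Riesz-Berezansky operator; the vector u is unique, and exists by the Riesz
   representation theorem in H_+. *)
Definition riesz_berezansky (phi : Hminus) : Hplus :=
  xget 0 [set u | forall f, pairing f phi = dotp f u].

Lemma riesz_inv_subproof (u : Hplus) :
  (dotp u : Hplus -> R[i]^o) \in antilinear_bounded.
Proof.
apply/mem_set; split; last by exists `|u|; exact: dotp_CS.
move=> c f g.
by rewrite (formDr dotp_linearl dotpC) (formZr dotp_linearl dotpC).
Qed.

Lemma riesz_berezansky_surj (u : Hplus) :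
  exists phi, riesz_berezansky phi = u.
Proof.
exists (HMinus (riesz_inv_subproof u)); rewrite /riesz_berezansky.
case: xgetP => [v _ h|/(_ u)[]]; last by move=> f; rewrite dotpC.
apply/eqP; rewrite -subr_eq0; apply/eqP/dotp_eq0.
have e w : dotp w v = dotp w u by rewrite -h /pairing /= -dotpC.
by rewrite (formDr dotp_linearl dotpC) e -(formDr dotp_linearl dotpC) subrr
  (form0r dotp_linearl dotpC).
Qed.

(* [H_+, H_-] *)
Definition bounded_linear : {pred Hplus -> Hminus} :=
  mem [set B : Hplus -> Hminus | linear B /\
    exists M : R[i], forall f, `|B f| <= M * `|f|].

Record biop := BiOp {
  biop_fun :> Hplus -> Hminus;
  biop_mem : biop_fun \in bounded_linear
}.

HB.instance Definition _ := [isSub for biop_fun].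
HB.instance Definition _ := [Choice of biop by <:].

Lemma bounded_linear_submod : submod_closed bounded_linear.
Proof.
split.
  have E f : (0 : Hplus -> Hminus) f = 0 by [].
  apply/mem_set; split; first by move=> c f g; rewrite !E scaler0 addr0.
  by exists 0 => f; rewrite E mul0r normr0.
move=> c u v /set_mem[lu [M uM]] /set_mem[lv [N vN]]; apply/mem_set; split.
  move=> d f g; rewrite !fctE lu lv !scalerDr addrACA; congr (_ + _).
  by rewrite !scalerA (mulrC c).
exists (`|c| * M + N) => f; rewrite !fctE mulrDl.
apply: le_trans (ler_normD _ _) _; rewrite lerD // normrZ -mulrA.
by rewrite ler_wpM2l.
Qed.

HB.instance Definition _ := GRing.isSubmodClosed.Build _ _ bounded_linear
  bounded_linear_submod.
HB.instance Definition _ := [SubChoice_isSubLmodule of biop by <:].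

Lemma biop_linear (B : biop) : linear B.
Proof. by have /set_mem[] := valP B. Qed.

Lemma biop_bounded (B : biop) : exists M : R[i], forall f, `|B f| <= M * `|f|.
Proof. by have /set_mem[] := valP B. Qed.

Lemma hminus_norm_lub (phi : Hminus) (r : R[i]) : 0 <= r ->
  (forall f, `|phi f : R[i]| <= r * `|f|) -> `|phi| <= r.
Proof.
move=> r0 phir; rewrite -[r]ger0_norm // -re_normE.
rewrite -[`|phi|]/((normm phi)%:C) lecR; apply: normm_lub => f f1.
rewrite re_normE (ger0_norm r0).
by apply: le_trans (phir f) _; rewrite ler_piMr.
Qed.

Lemma biop_bounded_ge0 (B : biop) :
  exists2 M : R[i], 0 <= M & forall f, `|B f| <= M * `|f|.
Proof.
have [M BM] := biop_bounded B; exists `|M| => // f.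
apply: le_trans (BM f) _; rewrite -[in leRHS](normr_id f) -normrM.
apply: real_ler_norm; exact: ger0_real (le_trans _ (BM f)).
Qed.

Lemma biop_adj_subproof1 (B : biop) (f : Hplus) :
  (fun h => pairing f (B h) : R[i]^o) \in antilinear_bounded.
Proof.
apply/mem_set; split.
  move=> c h k; rewrite /pairing biop_linear hminusD hminusZ.
  by rewrite rmorphD rmorphM.
have [M M0 BM] := biop_bounded_ge0 B; exists (M * `|f|) => h.
rewrite /pairing norm_conjC; apply: le_trans (hminus_norm_le _ _) _.
by rewrite mulrAC ler_wpM2r.
Qed.

Lemma biop_adj_subproof2 (B : biop) :
  (fun f => HMinus (biop_adj_subproof1 B f)) \in bounded_linear.
Proof.
apply/mem_set; split.
  move=> c f g; apply/val_inj/funext => h /=; rewrite /pairing.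
  rewrite hminus_antilinear rmorphD rmorphM /= conjCK.
  by [].
have [M M0 BM] := biop_bounded_ge0 B; exists M => f.
apply: hminus_norm_lub => [|h /=]; first by rewrite mulr_ge0.
rewrite /pairing norm_conjC; apply: le_trans (hminus_norm_le _ _) _.
by rewrite mulrAC ler_wpM2r.
Qed.

(* The adjoint with respect to the pairing: (B^* f, h) = (f, B h). *)
Definition biop_adj (B : biop) : biop := BiOp (biop_adj_subproof2 B).

Definition re_biop (B : biop) : biop := 2^-1 *: (B + biop_adj B).
Definition im_biop (B : biop) : biop := (2 * 'i)^-1 *: (B - biop_adj B).

Lemma rank1_subproof (u v : Hminus) :
  (fun f => pairing f u *: v) \in bounded_linear.
Proof.
apply/mem_set; split.
  move=> c f g; rewrite /pairing hminus_antilinear rmorphD rmorphM /= conjCK.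
  by rewrite scalerDl scalerA.
exists (`|u| * `|v|) => f; rewrite normrZ /pairing norm_conjC mulrAC.
by rewrite ler_wpM2r // hminus_norm_le.
Qed.

(* (., u) v *)
Definition rank1 (u v : Hminus) : biop := BiOp (rank1_subproof u v).

Lemma Astar_biop_subproof : (fun f => emb (Astar f)) \in bounded_linear.
Proof.
apply/mem_set; split.
  move=> c f g; apply/val_inj/funext => h /=.
  rewrite Astar_linear (formDl (@dot_linearl R H)).
  by rewrite (formZl (@dot_linearl R H)).
exists 1 => f; rewrite mul1r; apply: hminus_norm_lub => // h /=.
apply: le_trans (_ : `|Astar f| * `|val h| <= _).
  exact: dot_CS.
by rewrite ler_pM // ?norm_Astar_le ?norm_le_plus.
Qed.

Definition Astar_biop : biop := BiOp Astar_biop_subproof.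

Definition biop_extends (B : biop) (S : set (H * H)) :=
  forall f h, S (f, h) -> exists2 u : Hplus, val u = f & B u = emb h.

Definition quasi_kernel (B : biop) : set (H * H) :=
  [set p | exists2 u : Hplus, val u = p.1 & B u = emb p.2].

Definition self_adjoint_biextension (B : biop) :=
  biop_extends B A /\ biop_adj B = B.

Definition t_self_adjoint (B : biop) :=
  self_adjoint_biextension B /\ self_adjoint (quasi_kernel B).

(* (B - z I)^-1 phi, where I is the inclusion of H_+ in H_-. The total function
   returns 0 if the equation has no solution. *)
Definition biop_resolvent (B : biop) (z : R[i]) (phi : Hminus) : Hplus :=
  xget 0 [set x : Hplus | B x - z *: emb (val x) = phi].

Definition star_extension (T : set (H * H)) (B : biop) :=
  [/\ quasi_self_adjoint_extension A T, resolvent_set T !=set0,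
      A `<=` T /\ biop_extends B T,
      A `<=` adj T /\ biop_extends (biop_adj B) (adj T)
    & t_self_adjoint (re_biop B)].

(* K^* for K in [C, H_-], characterized by (f, K c) = K^* f * c^* . A linear K is
   bounded because its domain is C. *)
Definition channel_adj (K : R[i]^o -> Hminus) (f : Hplus) : R[i] :=
  pairing f (K 1).

Lemma channel_adjP (K : {linear R[i]^o -> Hminus}) f (c : R[i]) :
  pairing f (K c) = channel_adj K f * c^*.
Proof.
by rewrite -[in LHS](mulr1 c) (linearZ_LR K) /pairing hminusZ rmorphM mulrC.
Qed.

Record Lsystem := LSystem {
  main : set (H * H);
  state : biop;
  channel : {linear R[i]^o -> Hminus};
  Lsystem_deficiency : deficiency_indices A 1 1;
  Lsystem_main : quasi_self_adjoint_extension A main;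
  Lsystem_dissipative : dissipative main;
  Lsystem_resolvent : resolvent_set main !=set0;
  Lsystem_state : star_extension main state;
  Lsystem_channel : forall f, im_biop state f = channel (channel_adj channel f)
}.

Definition transfer (L : Lsystem) (z : R[i]) : R[i] :=
  1 - 2 * 'i * channel_adj (channel L)
                 (biop_resolvent (state L) z (channel L 1)).

(* Re A - z is invertible on the range of K for every nonreal z, since its
   quasi-kernel is self-adjoint. The formula therefore defines the function on
   the whole of both half-planes, where it coincides with the analytic
   continuation of its restriction to the resolvent set of the main operator. *)
Definition impedance (L : Lsystem) (z : R[i]) : R[i] :=
  channel_adj (channel L) (biop_resolvent (re_biop (state L)) z (channel L 1)).

Definition c_entropy (L : Lsystem) : \bar R :=
  let w := complex.Re `|transfer L (- 'i)| in
  if w == 0 then +oo%E else (- ln w)%:E.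

(* The possible values of Im (T y, y) with y = g'_+ - kappa g'_- in dom T, over
   all (+)-normalized bases g_+, g_- (g'_+ and g'_- being their multiples by
   sqrt 2) for which kappa lies in [0, 1]. The value is 1 - kappa^2, whatever the
   basis. *)
Definition dissipation_values (T : set (H * H)) : set R :=
  [set d | exists (gp gm : Hplus) (kappa : R[i]),
    let y := (sqrtC 2 *: val gp - kappa *: (sqrtC 2 *: val gm)) in
    [/\ defect A 'i (val gp) /\ `|gp| = 1, defect A (- 'i) (val gm) /\ `|gm| = 1,
        `|kappa| < 1 /\ 0 <= kappa <= 1, dom T y
      & d = complex.Im (dot (app T y) y)]].

Definition dissipation_coefficient (T : set (H * H)) : R :=
  xget 0 (dissipation_values T).

End Plus.

(* Main.v *)
(* By von Neumann's decomposition an element of H_+ is f0 + al g_+ + be g_-, with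
   f0 in the domain of the symmetric operator, and Green's formula reads
   (A^* f, h) - (f, A^* h) = i (al f conj(al h) - be f conj(be h)).
   Hence the extensions in play are the restrictions of A^* to lines c al = d be,
   and the state-space operator has real part
   A^* - (i/2) (al - be) (phi + psi) and imaginary part
   (a/2) (al + be) (phi + psi). A vector x in Ker(A^* - z) thus yields the
   impedance i a (al x + be x) / (al x - be x), and taking
   x = g + (z - i) (A - z)^-1 g turns this into a M(z).
   Conversely, in an L-system over the same symmetric operator the channel vector
   K 1 annihilates the domain of that operator, hence lies in the span of phi and
   psi; since the main operator is not symmetric, the correction
   Re AA - A^* = (al - be) v has v proportional to K 1. Self-adjointness of Re AA
   and the single value V(i) = a i then force v = -(i/2) (phi + psi) and
   K 1 = w (phi + psi) with |w|^2 = a/2, so the state-space operator is the one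
   above, and its quasi-kernel is the main operator. *)

From HB Require Import structures.
Require Import Defs.
From mathcomp Require Import all_boot all_order all_algebra.
From mathcomp Require Import complex ring.
From mathcomp Require Import all_classical all_reals all_analysis.

Import Order.TTheory GRing.Theory Num.Theory numFieldNormedType.Exports.

Local Open Scope classical_set_scope.
Local Open Scope complex_scope.
Local Open Scope ring_scope.

(** * Projections and closed ranges *)

Section Projection.
Context {R : realType} {H : hilbertType R}.
Implicit Types (u v w h : H) (c : R[i]).

Lemma dotDl u v w : dot (u + v) w = dot u w + dot v w.
Proof. exact: (@Defs.formDl _ _ (@dot R H) (@dot_linearl R H)). Qed.

Lemma dotDr w u v : dot w (u + v) = dot w u + dot w v.
Proof. exact: (@Defs.formDr _ _ (@dot R H) (@dot_linearl R H) (@dotC R H)). Qed.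

Lemma dotZl c u w : dot (c *: u) w = c * dot u w.
Proof. exact: (@Defs.formZl _ _ (@dot R H) (@dot_linearl R H)). Qed.

Lemma dotZr c u w : dot u (c *: w) = c^* * dot u w.
Proof. exact: (@Defs.formZr _ _ (@dot R H) (@dot_linearl R H) (@dotC R H)). Qed.

Lemma dot0l w : dot 0 w = 0.
Proof. by rewrite -(scale0r w) dotZl mul0r. Qed.

Lemma dot0r w : dot w 0 = 0.
Proof. by rewrite -(scale0r w) dotZr rmorph0 mul0r. Qed.

Lemma dotNl u w : dot (- u) w = - dot u w.
Proof. by rewrite -scaleN1r dotZl mulN1r. Qed.

Lemma dotNr u w : dot u (- w) = - dot u w.
Proof. by rewrite -scaleN1r dotZr rmorphN1 mulN1r. Qed.

Definition dotE := (dotDl, dotDr, dotZl, dotZr, dotNl, dotNr).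

Lemma parallelogram u v :
  `|u - v| ^+ 2 + `|u + v| ^+ 2 = 2 * `|u| ^+ 2 + 2 * `|v| ^+ 2.
Proof. by rewrite -!dot_norm !dotE; ring. Qed.

(** A positive element of [R[i]] is real, so the Archimedean property of [R] applies to its real
    part. *)
Lemma archi_invS (e : R[i]) : 0 < e -> exists n : nat, (n.+1%:R^-1 : R[i]) < e.
Proof.
move=> e0; have er : e = (complex.Re e)%:C by rewrite RRe_real // gtr0_real.
have re0 : 0 < complex.Re e by rewrite -ltcR -er.
exists (Num.bound (complex.Re e)^-1); rewrite er.
rewrite -(rmorph_nat (real_complex R)) -fmorphV ltcR.
rewrite invf_plt ?posrE //.
apply: lt_trans (_ : (Num.bound (complex.Re e)^-1)%:R < _).
  by rewrite archi_boundP // invr_ge0 ltW.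
by rewrite ltr_nat.
Qed.

Lemma leS_invn (N n : nat) : (N <= n)%N -> (n.+1%:R^-1 : R[i]) <= N.+1%:R^-1.
Proof. by move=> Nn; rewrite lef_pV2 ?posrE ?ltr0Sn // ler_nat ltnS. Qed.

(** The infimum of the squared distances is taken in [R], because the order of [R[i]] is only
    partial. *)
Lemma minimizing_seq (V : set H) h : V 0 -> exists m : R[i],
  (forall v, V v -> m <= `|h - v| ^+ 2) /\
  exists u : nat -> H, forall n, V (u n) /\ `|h - u n| ^+ 2 <= m + n.+1%:R^-1.
Proof.
move=> V0; pose D := [set complex.Re (`|h - v| ^+ 2) | v in V].
have sq v : (complex.Re (`|h - v| ^+ 2))%:C = `|h - v| ^+ 2.
  by rewrite RRe_real // realX // normr_real.
have Dinf : has_inf D.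
  split; first by exists (complex.Re (`|h - 0| ^+ 2)); exists 0.
  by exists 0 => _ [v Vv <-]; rewrite -lecR sq exprn_ge0.
exists (inf D)%:C; split=> [v Vv|].
  rewrite -sq lecR; apply: ge_inf; [exact: Dinf.2|by exists v].
have : forall n : nat, exists v, V v /\ `|h - v| ^+ 2 <= (inf D)%:C + n.+1%:R^-1.
  move=> n; have e0 : 0 < n.+1%:R^-1 :> R by rewrite invr_gt0 ltr0Sn.
  have [_ [v Vv <-] lt] := inf_adherent e0 Dinf; exists v; split=> //.
  rewrite -sq -(rmorph_nat (real_complex R)) -fmorphV -rmorphD lecR.
  exact: ltW.
by move=> /choice[u uP]; exists u.
Qed.

(** [V] is not assumed closed, so the projection is only a limit of elements of [V]. The
    parallelogram law makes a minimizing sequence Cauchy, and minimality makes the residual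
    orthogonal to [V]. *)
Lemma orthogonal_projection (V : set H) h :
  V 0 -> (forall c p q, V p -> V q -> V (c *: p + q)) ->
  exists (u : nat -> H) v, [/\ forall n, V (u n), u @ \oo --> v &
    forall w, V w -> dot (h - v) w = 0].
Proof.
move=> V0 Vlin; have [m [mle [u uP]]] := minimizing_seq _ h V0.
have cauchy_u N n : (N <= n)%N -> `|u N - u n| ^+ 2 <= 4 * N.+1%:R^-1.
  move=> Nn; have [VN leN] := uP N; have [Vn len] := uP n.
  (* The midpoint lies in [V], hence at squared distance at least [m] from [h]; this bounds the
     other diagonal of the parallelogram. *)
  have Vmid : V (2^-1 *: (u N + u n)).
    rewrite scalerDr; apply: (Vlin) => //.
    by have := Vlin 2^-1 _ _ Vn V0; rewrite addr0.
  have := parallelogram (h - u n) (h - u N).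
  have -> : h - u n - (h - u N) = u N - u n by rewrite opprB addrC addrA subrK.
  have -> : h - u n + (h - u N) = (2 : R[i]) *: (h - 2^-1 *: (u N + u n)).
    rewrite scalerBr scalerA divff ?pnatr_eq0 // scale1r scaler_nat mulr2n.
    by rewrite addrACA -opprD [u n + _]addrC.
  rewrite normrZ exprMn normr_nat => E.
  have := mle _ Vmid; have := leS_invn _ _ Nn; move: E leN len.
  set A := `|h - u n| ^+ 2; set B := `|h - u N| ^+ 2.
  set C := `|u N - u n| ^+ 2; set D := `|h - _| ^+ 2.
  set x := _^-1; set y := _^-1 => E leN len yx mD.
  rewrite -subr_ge0.
  have -> : 4 * x - C =
      2 * (m + x - B) + 2 * (m + y - A) + 2 * (x - y) + 4 * (D - m).
    have -> : C = 2 * A + 2 * B - 4 * D by rewrite -E; ring.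
    ring.
  by rewrite !addr_ge0 // mulr_ge0 // subr_ge0.
have /cauchy_cvgP/cvg_ex[v uv] : cauchy (u @ \oo).
  apply/cauchyP => e e0.
  have [N Ne] := archi_invS _ (divr_gt0 (exprn_gt0 2 e0) (ltr0Sn _ 3)).
  exists (u N); exists N => // n /= Nn; rewrite -ball_normE /=.
  rewrite -(@ltr_pXn2r _ 2) ?nnegrE ?(ltW e0) //.
  by apply: le_lt_trans (cauchy_u _ _ Nn) _; rewrite mulrC -ltr_pdivlMr ?ltr0Sn.
exists u, v; split=> // [n|w Vw]; first by have [] := uP n.
(* Moving [u n] by the optimal multiple [t] of [w] lowers the squared distance by |d|^2 / |w|^2,
   which cannot exceed the slack 1 / (n + 1). *)
have small n : `|dot (h - u n) w| ^+ 2 <= `|w| ^+ 2 * n.+1%:R^-1.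
  have [->|w0] := eqVneq w 0.
    by rewrite dot0r !normr0 expr0n mul0r.
  have [Vn len] := uP n.
  have w2 : 0 < `|w| ^+ 2 by rewrite exprn_gt0 // normr_gt0.
  set d := dot _ _; pose t := d / `|w| ^+ 2.
  have := mle _ (Vlin t _ _ Vw Vn).
  have -> : `|h - (t *: w + u n)| ^+ 2 = `|h - u n| ^+ 2 - `|d| ^+ 2 / `|w| ^+ 2.
    have -> : h - (t *: w + u n) = (h - u n) + (- t) *: w.
      by rewrite opprD addrCA scaleNr addrC.
    rewrite /t /d; move: (h - u n) => p.
    rewrite -(dot_norm (_ + _)) !dotE !dot_norm (dotC p w).
    rewrite rmorphN /= fmorph_div /= (geC0_conj (ltW w2)) normCK.
    by field; rewrite normr_eq0.
  move=> mle'; rewrite -ler_pdivrMl //.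
  have := le_trans mle' (lerB len (lexx _)).
  by rewrite lerBrDr lerD2l mulrC.
apply/eqP/negPn/negP => nz.
(* For large [n], both (h - u n, w) and (v - u n, w) are smaller than half of (h - v, w) in modulus,
   which is absurd. *)
have d0 : 0 < `|dot (h - v) w| / 2 by rewrite divr_gt0 ?normr_gt0.
have w0 : 0 < `|w|.
  by rewrite normr_gt0; apply: contraNneq nz => ->; rewrite dot0r.
have [N Ne] := archi_invS _ (divr_gt0 (exprn_gt0 2 d0) (exprn_gt0 2 w0)).
have /cvgrPdist_lt/(_ _ (divr_gt0 d0 w0))[N' _ uN'] := uv.
pose n := maxn N N'.
have {}uN' : `|v - u n| * `|w| < `|dot (h - v) w| / 2.
  by rewrite -ltr_pdivlMr //; apply: uN'; exact: leq_maxr.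
have : `|dot (h - u n) w| < `|dot (h - v) w| / 2.
  rewrite -(@ltr_pXn2r _ 2) ?nnegrE ?(ltW d0) //.
  apply: le_lt_trans (small n) _; rewrite mulrC -ltr_pdivlMr ?exprn_gt0 //.
  by apply: le_lt_trans (leS_invn _ _ (leq_maxl N N')) Ne.
move=> /ltrD /(_ uN'); rewrite -splitr.
move=> /(le_lt_trans (lerD (lexx _) (dot_CS (v - u n) w))).
have -> : dot (h - v) w = dot (h - u n) w - dot (v - u n) w.
  by rewrite -dotNl -dotDl opprB addrA subrK.
by move/(le_lt_trans (ler_normB _ _)); rewrite ltxx.
Qed.

End Projection.

(** * Closed ranges and a criterion for the resolvent set *)

Section Resolvent.
Context {R : realType} {H : hilbertType R}.
Implicit Types (S : set (H * H)) (u v w h : H) (c z : R[i]).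

Lemma dot_continuous u : continuous (dot u : H -> R[i]^o).
Proof.
move=> v; apply/cvgrPdist_lt => e e0.
have u0 : 0 < `|u| + 1 by rewrite ltr_wpDl.
have : \forall w \near v, `|v - w| < e / (`|u| + 1).
  by apply/nbhs_normP; exists (e / (`|u| + 1)) => //=; rewrite divr_gt0.
apply: filterS => w; rewrite ltr_pdivlMr // => vw.
rewrite -dotNr -dotDr; apply: le_lt_trans (dot_CS _ _) _.
by apply: le_lt_trans vw; rewrite mulrC ler_wpM2l // lerDl.
Qed.

(** The graph of an adjoint is an intersection of zero sets of continuous functions. *)
Lemma adj_closed S : closed (adj S).
Proof.
have -> : adj S = \bigcap_(q in S)
    ((fun p : H * H => dot q.2 p.1 - dot q.1 p.2 : R[i]^o) @^-1` [set 0]).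
  apply/seteqP; split=> p Sp q Sq /=; first by rewrite (Sp q Sq) subrr.
  by apply/eqP; rewrite -subr_eq0; apply/eqP; exact: Sp Sq.
apply: closed_bigI => q _; apply: closed_comp => [p _|]; last first.
  apply: (@accessible_closed_set1 (R[i]^o : topologicalType)).
  exact/hausdorff_accessible/(@norm_hausdorff _ (R[i]^o : normedModType R[i])).
apply: (@cvgB _ (R[i]^o : normedModType R[i])); apply: continuous_comp.
- exact: cvg_fst.
- exact: dot_continuous.
- exact: cvg_snd.
- exact: dot_continuous.
Qed.

Definition bounded_below S z := exists M : R[i], forall f w,
  S (f, w) -> `|f| <= M * `|w - z *: f|.

(** Project [h] onto the range of S - z. The residual is orthogonal to the range, so it lies in the
    kernel of the adjoint at [z^*]; the lower bound and the closed graph put the projection itself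
    in the range. *)
Lemma range_decomposition S z h : operator S -> closed S -> bounded_below S z ->
  exists f w n, [/\ S (f, w), adj S (n, z^* *: n) & h = w - z *: f + n].
Proof.
move=> [S0 Slin _] Scl [M SM].
pose V := [set v | exists2 p, S p & v = p.2 - z *: p.1].
have [||u [v [Vu uv vV]]] := orthogonal_projection V h.
- by exists 0 => //=; rewrite scaler0 subrr.
- move=> c p q [p' Sp ->] [q' Sq ->]; exists (c *: p' + q'); first exact: Slin.
  by rewrite /= scalerBr scalerDr opprD [RHS]addrACA !scalerA mulrC.
have /choice[p pP] : forall n, exists p, S p /\ u n = p.2 - z *: p.1.
  by move=> n; have [p] := Vu n; exists p.
pose N := `|M| + 1; have N0 : 0 < N by rewrite ltr_wpDl.
have SN f w : S (f, w) -> `|f| <= N * `|w - z *: f|.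
  move=> /SM le; apply: le_trans (_ : `|M| * `|w - z *: f| <= _).
    rewrite -[in leRHS](normr_id (_ - _)) -normrM ger0_norm //.
    exact: le_trans le.
  by rewrite ler_wpM2r // lerDl.
(* The lower bound transfers the Cauchy property from the images [u n] to their preimages. *)
have /cauchy_cvgP/cvg_ex[f pf] : cauchy ((fun n => (p n).1) @ \oo).
  apply/cauchyP => e e0.
  have e2 : 0 < e / 2 / N by rewrite !divr_gt0.
  have /cvgrPdist_lt/(_ _ e2)[k _ uk] := uv.
  exists (p k).1; exists k => // n /= kn; rewrite -ball_normE /=.
  have [Sk Ek] := pP k; have [Sn En] := pP n.
  have Skn : S ((p k).1 - (p n).1, (p k).2 - (p n).2).
    have -> : ((p k).1 - (p n).1, (p k).2 - (p n).2) = (-1 : R[i]) *: p n + p k.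
      by rewrite scaleN1r [in RHS]addrC.
    exact: Slin.
  apply: le_lt_trans (SN _ _ Skn) _.
  have -> : (p k).2 - (p n).2 - z *: ((p k).1 - (p n).1) = u k - u n.
    by rewrite Ek En scalerBr !opprD !opprK addrACA.
  rewrite mulrC -ltr_pdivlMr //.
  have -> : u k - u n = (v - u n) - (v - u k).
    by rewrite opprB [in RHS]addrC addrA subrK.
  apply: le_lt_trans (ler_normB _ _) _.
  have -> : e / N = e / 2 / N + e / 2 / N by rewrite -mulrDl -splitr.
  by rewrite ltrD //; apply: uk => //=.
have pw : (p n).2 @[n --> \oo] --> v + z *: f.
  have -> : (fun n => (p n).2) = (fun n => u n + z *: (p n).1).
    by apply/funext => n; have [_ ->] := pP n; rewrite subrK.
  by apply: cvgD => //; apply: cvgZl_tmp.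
exists f, (v + z *: f), (h - v); split.
- apply: (@closed_cvg _ _ (nbhs \oo) _ (fun n => ((p n).1, (p n).2)) S Scl).
    by apply: nearW => n /=; have [+ _] := pP n; case: (p n).
  apply: (@cvg_pair _ H H \oo _ _ _ _ _ _ _ pf pw).
- move=> q Sq /=; have := vV (q.2 - z *: q.1) (ex_intro2 _ _ q Sq erefl).
  move: (h - v) => m; rewrite dotC => /eqP; rewrite conjC_eq0 !dotE conjCK.
  by rewrite subr_eq0 => /eqP.
- by rewrite addrK subrKC.
Qed.

(** Triviality of the adjoint kernel gives surjectivity through [range_decomposition]; the lower
    bound gives injectivity. *)
Lemma resolvent_setP S z : operator S -> closed S -> bounded_below S z ->
  (forall n, adj S (n, z^* *: n) -> n = 0) -> resolvent_set S z.
Proof.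
move=> Sop Scl Sb Sn; split=> // h.
have [f [w [n [Sfw /Sn n0 E]]]] := range_decomposition _ _ h Sop Scl Sb.
exists f; split; first by rewrite E n0 addr0 subrK.
move=> g Sg; have [M SM] := Sb; have [_ Slin _] := Sop.
have Sfg : S (f - g, w - (h + z *: g)).
  have -> : (f - g, w - (h + z *: g)) = (-1 : R[i]) *: (g, h + z *: g) + (f, w).
    by rewrite scaleN1r [in RHS]addrC.
  exact: Slin.
apply/eqP; rewrite -subr_eq0 -normr_le0; apply: le_trans (SM _ _ Sfg) _.
suff -> : w - (h + z *: g) - z *: (f - g) = 0 by rewrite normr0 mulr0.
rewrite E n0 addr0 -[_ - _ + z *: g]addrA opprD addrA subrr add0r.
rewrite scalerBr opprD opprK.
exact: subrr.
Qed.

End Resolvent.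

(** * Lower bounds from the quadratic form, and the Weyl-Titchmarsh function *)

Section BoundedBelow.
Context {R : realType} {H : hilbertType R}.
Implicit Types (S : set (H * H)) (z : R[i]).

Lemma normC_ge_normIm (x : R[i]) : `|'Im x| <= `|x|.
Proof.
rewrite -(@ler_pXn2r _ 2) ?nnegrE // [leRHS]normC2_Re_Im real_normK ?Creal_Im //.
by rewrite lerDr -realEsqr Creal_Re.
Qed.

(** Apply Cauchy-Schwarz to the form and divide by |f|. *)
Lemma form_bounded_below S z (e : R[i]) : 0 < e ->
  (forall f w, S (f, w) -> e * `|f| ^+ 2 <= `|dot (w - z *: f) f|) ->
  bounded_below S z.
Proof.
move=> e0 eS; exists e^-1 => f w /eS le; rewrite ler_pdivlMl //.
have [->|f0] := eqVneq f 0; first by rewrite normr0 mulr0.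
rewrite -(@ler_pM2r _ `|f|) ?normr_gt0 // -mulrA -expr2.
exact: le_trans le (dot_CS _ _).
Qed.

(** Since (w, f) is real, the form of S - z at [f] has imaginary part - Im z |f|^2. *)
Lemma symmetric_bounded_below S z :
  symmetric_operator S -> complex.Im z != 0 -> bounded_below S z.
Proof.
move=> Ssym z0; apply: (@form_bounded_below _ _ `|'Im z|) => [|f w Sfw].
  by rewrite normr_gt0 -complexIm -[0]/((0 : R)%:C) (inj_eq (@complexI R)).
have wf : dot w f \is Num.real.
  by apply/CrealP; rewrite -dotC; have /= -> := Ssym _ Sfw _ Sfw.
apply: le_trans (normC_ge_normIm _).
rewrite !dotE dot_norm raddfB /= (Creal_ImP _ wf) sub0r normrN.
rewrite ImMr ?realX ?normr_real //= normrM.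
by rewrite [`|_ ^+ 2|]ger0_norm ?exprn_ge0 // mulrC.
Qed.

(** The form of S + i has imaginary part Im (w, f) + |f|^2, which is at least |f|^2. *)
Lemma dissipative_bounded_below S : dissipative S -> bounded_below S (- 'i).
Proof.
move=> Sdis; apply: (@form_bounded_below _ _ 1) => // f w Sfw.
have wf : 0 <= 'Im (dot w f) by rewrite -complexIm ler0c; exact: Sdis.
apply: le_trans (normC_ge_normIm _).
rewrite !dotE dot_norm mulNr opprK raddfD /= mul1r ImMil.
rewrite (Creal_ReP _ _) ?realX ?normr_real // ger0_norm ?lerDr //.
by rewrite addr_ge0 // exprn_ge0.
Qed.

(** The adjoint kernel is the kernel of [S] itself at [z^*], trivial by the lower bound there. *)
Lemma self_adjoint_resolvent S z :
  self_adjoint S -> complex.Im z != 0 -> resolvent_set S z.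
Proof.
move=> [Sop Sadj] z0.
have Ssym : symmetric_operator S by rewrite /symmetric_operator Sadj.
apply: resolvent_setP => //; first by rewrite -Sadj; exact: adj_closed.
  exact: symmetric_bounded_below.
rewrite Sadj => n Sn; have [|M SM] := symmetric_bounded_below _ z^* Ssym.
  rewrite -[0](raddf0 (@complex.Im R)).
  by case: (z) z0 => [? ?] /=; rewrite oppr_eq0.
by have := SM _ _ Sn; rewrite subrr normr0 mulr0 normr_le0 => /eqP.
Qed.

Lemma has_dim1 (V : set H) a b : has_dim V 1 -> V a -> a != 0 -> V b ->
  exists t : R[i], b = t *: a.
Proof.
move=> [e _ ->] [c]; rewrite big_ord1 => -> ca0 [d]; rewrite big_ord1 => ->.
exists (d ord0 / c ord0); rewrite scalerA divfK //.
by apply: contraNneq ca0 => ->; rewrite scale0r.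
Qed.

Lemma weyl_titchmarsh_resolvent (S : set (H * H)) (g : H) z :
  operator S -> resolvent_set S z -> exists2 x, S (x, g + z *: x) &
  weyl_titchmarsh S g z = z * dot (g + z *: x) g + dot x g.
Proof.
move=> [_ _ Sfun] [/(_ g)[x [Sx _]] _]; exists (resolvent S z g).
  by rewrite /resolvent; case: xgetP => [y _ //|/(_ x)/(_ Sx)].
have Sr : S (resolvent S z g, g + z *: resolvent S z g).
  by rewrite /resolvent; case: xgetP => [y _ //|/(_ x)/(_ Sx)].
rewrite /weyl_titchmarsh /=.
have -> : app S (resolvent S z g) = g + z *: resolvent S z g.
  by apply: (Sfun _ _ _ _ Sr); apply: Defs.appP; exists (g + z *: resolvent S z g).
by rewrite [LHS]dotDl dotZl.
Qed.

(** At z = i the two terms containing the resolvent vector cancel, leaving i |g|^2. *)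
Lemma weyl_titchmarsh_i (S : set (H * H)) (g : H) :
  self_adjoint S -> `|g| = 1 -> weyl_titchmarsh S g 'i = 'i.
Proof.
move=> Ssa g1; have i0 : complex.Im ('i : R[i]) != 0 by rewrite -complexiE oner_neq0.
have [x _ ->] :=
  weyl_titchmarsh_resolvent S g _ Ssa.1 (self_adjoint_resolvent _ _ Ssa i0).
rewrite dotDl dotZl dot_norm g1 expr1n mulrDr mulr1 mulrA -expr2 sqrCi.
by rewrite mulN1r subrK.
Qed.

End BoundedBelow.

(** * Von Neumann's decomposition *)

(* Turns identities between vectors into scalar ones, which [ring] can settle. *)
Lemma eq_dot {R : realType} {H : hilbertType R} (u v : H) :
  (forall x, dot u x = dot v x) -> u = v.
Proof.
move=> uv; apply/eqP; rewrite -subr_eq0; apply/eqP/dot_eq0.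
by rewrite dotDl dotNl uv subrr.
Qed.

(** * Calculus in [Hplus] *)

Section HplusForms.
Context {R : realType} {H : hilbertType R} {A0 : symop H}.
Implicit Types (f g h u : Hplus A0) (c z : R[i]) (phi : Hminus A0).

Lemma dotpDl f g h : dotp (f + g) h = dotp f h + dotp g h.
Proof. exact: (@Defs.formDl _ _ _ (@dotp_linearl R H A0)). Qed.

Lemma dotpDr h f g : dotp h (f + g) = dotp h f + dotp h g.
Proof. exact: (@Defs.formDr _ _ _ (@dotp_linearl R H A0) (@dotpC R H A0)). Qed.

Lemma dotpZl c f h : dotp (c *: f) h = c * dotp f h.
Proof. exact: (@Defs.formZl _ _ _ (@dotp_linearl R H A0)). Qed.

Lemma dotpZr c f h : dotp f (c *: h) = c^* * dotp f h.
Proof. exact: (@Defs.formZr _ _ _ (@dotp_linearl R H A0) (@dotpC R H A0)). Qed.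

Lemma dotpNl f h : dotp (- f) h = - dotp f h.
Proof. by rewrite -scaleN1r dotpZl mulN1r. Qed.

Lemma dotpNr f h : dotp f (- h) = - dotp f h.
Proof. by rewrite -scaleN1r dotpZr rmorphN1 mulN1r. Qed.

Definition dotpE := (dotpDl, dotpDr, dotpZl, dotpZr, dotpNl, dotpNr).

Lemma AstarD f g : Astar (f + g) = Astar f + Astar g.
Proof. by have := @Astar_linear _ _ A0 1 f g; rewrite !scale1r. Qed.

Lemma Astar0 : Astar (0 : Hplus A0) = 0.
Proof. by apply: (addIr (Astar (0 : Hplus A0))); rewrite -AstarD !add0r. Qed.

Lemma AstarZ c f : Astar (c *: f) = c *: Astar f.
Proof. by have := @Astar_linear _ _ A0 c f 0; rewrite !addr0 Astar0 addr0. Qed.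

Lemma AstarN f : Astar (- f) = - Astar f.
Proof. by rewrite -scaleN1r AstarZ scaleN1r. Qed.

Lemma valD f g : val (f + g) = val f + val g. Proof. by []. Qed.
Lemma valZ c f : val (c *: f) = c *: val f. Proof. by []. Qed.
Lemma valN f : val (- f) = - val f. Proof. by []. Qed.

Definition AstarE := (AstarD, AstarZ, AstarN).
Definition valE := (valD, valZ, valN).

Lemma adj_Hplus (x w : H) : adj A0 (x, w) ->
  exists2 f : Hplus A0, val f = x & Astar f = w.
Proof.
move=> Axw; have xA : x \in dom_adj A0 by apply/mem_set; exists w.
exists (HPlus xA) => //; apply: (adj_fun (A:=A0)); [exact: AstarP|exact: Axw].
Qed.

Lemma symop_Hplus (x w : H) : symop_graph A0 (x, w) ->
  exists2 f : Hplus A0, val f = x & Astar f = w.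
Proof. by move=> /(@symop_symmetric _ _ A0)/adj_Hplus. Qed.

Definition symop_dom f : Prop := symop_graph A0 (val f, Astar f).

Lemma defect_Astar f z : defect A0 z (val f) -> Astar f = z *: val f.
Proof. by move=> fz; apply: (adj_fun (A:=A0)); [exact: AstarP|exact: fz]. Qed.

End HplusForms.

(** Named so that a linear structure can be attached to it, as the channel of an [Lsystem]
    requires. *)
Definition line_channel {R : realType} {H : hilbertType R} {A0 : symop H}
  (v : Hminus A0) (c : R[i]^o) : Hminus A0 := c *: v.

Lemma line_channel_linear {R : realType} {H : hilbertType R} {A0 : symop H}
  (v : Hminus A0) : linear (line_channel v).
Proof.
by move=> c d e; rewrite /line_channel scalerDl scalerA.
Qed.

HB.instance Definition _ (R : realType) (H : hilbertType R) (A0 : symop H)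
  (v : Hminus A0) :=
  GRing.isLinear.Build R[i] R[i]^o (Hminus A0) *:%R (line_channel v)
    (line_channel_linear v).

Section Deficiency.
Context {R : realType} {H : hilbertType R} {A0 : symop H} (gp gm : Hplus A0).
Hypotheses (hdef : deficiency_indices A0 1 1)
  (hgp : defect A0 'i (val gp)) (hgm : defect A0 (- 'i) (val gm))
  (ngp : `|gp| = 1) (ngm : `|gm| = 1).
Implicit Types (f g h u : Hplus A0) (c z : R[i]).

(* The von Neumann decomposition of f is f0 + al f *: gp + be f *: gm, with f0 in
   the domain of A0. *)
Local Notation al f := (dotp f gp).
Local Notation be f := (dotp f gm).

Lemma Astar_gp : Astar gp = 'i *: val gp.
Proof. exact: defect_Astar. Qed.

Lemma Astar_gm : Astar gm = (- 'i) *: val gm.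
Proof. exact: defect_Astar. Qed.

(** The two terms of the (+)-product cancel: the defect subspaces at i and -i are (+)-orthogonal. *)
Lemma al_defect f : Astar f = (- 'i) *: val f -> al f = 0.
Proof.
move=> fE; rewrite /dotp fE Astar_gp !dotE conjCi mulrA mulrNN -expr2 sqrCi.
by rewrite mulN1r subrr.
Qed.

Lemma be_defect f : Astar f = 'i *: val f -> be f = 0.
Proof.
move=> fE; rewrite /dotp fE Astar_gm !dotE rmorphN /= conjCi opprK mulrA.
by rewrite -expr2 sqrCi mulN1r subrr.
Qed.

Lemma al_gm : al gm = 0. Proof. exact/al_defect/Astar_gm. Qed.
Lemma be_gp : be gp = 0. Proof. exact/be_defect/Astar_gp. Qed.

Lemma al_gp : al gp = 1.
Proof. by rewrite -(sqrtCK (al gp)) -[sqrtC _]/`|gp| ngp expr1n. Qed.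

Lemma be_gm : be gm = 1.
Proof. by rewrite -(sqrtCK (be gm)) -[sqrtC _]/`|gm| ngm expr1n. Qed.

(** On a defect vector at i the squared (+)-norm is twice the squared norm of [H]. *)
Lemma dot_gp : dot (val gp) (val gp) = 2^-1.
Proof.
have := al_gp; rewrite /dotp Astar_gp !dotE conjCi mulNr mulrN mulrA -expr2.
rewrite sqrCi mulN1r opprK => dd.
by rewrite -[LHS](mulfK (_ : 2 != 0)) ?pnatr_eq0 // mulr_natr mulr2n dd mul1r.
Qed.

Lemma dot_gm : dot (val gm) (val gm) = 2^-1.
Proof.
have := be_gm; rewrite /dotp Astar_gm !dotE rmorphN /= conjCi opprK mulNr.
rewrite mulrA -expr2 sqrCi mulN1r opprK => dd.
by rewrite -[LHS](mulfK (_ : 2 != 0)) ?pnatr_eq0 // mulr_natr mulr2n dd mul1r.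
Qed.

Lemma val_gp_neq0 : val gp != 0.
Proof.
apply/eqP => g0; have := dot_gp; rewrite g0 dot0l => /esym/eqP.
by rewrite invr_eq0 pnatr_eq0.
Qed.

Lemma val_gm_neq0 : val gm != 0.
Proof.
apply/eqP => g0; have := dot_gm; rewrite g0 dot0l => /esym/eqP.
by rewrite invr_eq0 pnatr_eq0.
Qed.

Lemma defect_gp x : defect A0 'i x -> exists t, x = t *: val gp.
Proof. exact: has_dim1 hdef.1 hgp val_gp_neq0. Qed.

Lemma defect_gm x : defect A0 (- 'i) x -> exists t, x = t *: val gm.
Proof. exact: has_dim1 hdef.2 hgm val_gm_neq0. Qed.

Lemma symop_dom_green f h : symop_dom f ->
  dot (Astar f) (val h) = dot (val f) (Astar h).
Proof. by move=> f0; exact: (AstarP h f0). Qed.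

Lemma al_symop f : symop_dom f -> al f = 0.
Proof.
move=> f0; rewrite /dotp Astar_gp dotZr (symop_dom_green _ gp f0) Astar_gp dotZr.
by rewrite conjCi mulrA mulrNN -expr2 sqrCi mulN1r subrr.
Qed.

Lemma be_symop f : symop_dom f -> be f = 0.
Proof.
move=> f0; rewrite /dotp Astar_gm dotZr (symop_dom_green _ gm f0) Astar_gm dotZr.
by rewrite rmorphN /= conjCi opprK mulrA -expr2 sqrCi mulN1r subrr.
Qed.

Lemma ImNi : complex.Im (- 'i : R[i]) != 0.
Proof. by rewrite -complexiE /= oppr_eq0 oner_eq0. Qed.

(** Decompose (A^* + i) f along the closed range of A0 + i and the defect space at i. This gives f =
    d' + s g_+ + s' g_- with [d'] in the domain of [A0], and the hypotheses kill [s] and [s']. *)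
Lemma von_neumann f : al f = 0 -> be f = 0 -> symop_dom f.
Proof.
move=> fp fm.
have [d [w [n [A0d An E]]]] := range_decomposition _ (- 'i) (Astar f + 'i *: val f)
  (symop_operator A0) (@symop_closed _ _ A0)
  (symmetric_bounded_below _ _ (@symop_symmetric _ _ A0) ImNi).
have [d' dE wE] := symop_Hplus _ _ A0d; subst d w.
move: An; rewrite rmorphN /= conjCi opprK => /defect_gp[t nE].
(* A^* + i maps n / (2i) to n, so it kills r. *)
pose s := t / (2 * 'i); pose r := f - d' - s *: gp.
have rE : Astar r = (- 'i) *: val r.
  rewrite /r !AstarE !valE Astar_gp !scaleNr opprK in E *.
  rewrite (canRL (addrK _) E) nE; apply: eq_dot => x; rewrite !dotE /s.
  by field; rewrite neq0Ci.
have [s' rE'] : exists s', val r = s' *: val gm.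
  by apply: defect_gm; have := AstarP r; rewrite rE.
have fE : f = d' + s *: gp + s' *: gm.
  apply/val_inj; rewrite !valE -rE' /r !valE; apply: eq_dot => x.
  by rewrite !dotE; ring.
have s0 : s = 0.
  move: fp; rewrite fE !dotpE (al_symop _ A0d) al_gp al_gm.
  by rewrite mulr0 mulr1 addr0 add0r.
have s0' : s' = 0.
  move: fm; rewrite fE !dotpE (be_symop _ A0d) be_gp be_gm.
  by rewrite mulr0 mulr1 addr0 add0r.
by rewrite fE s0 s0' !scale0r !addr0.
Qed.

Lemma von_neumann_decomposition f : exists2 f0, symop_dom f0 &
  f = f0 + al f *: gp + be f *: gm.
Proof.
exists (f - al f *: gp - be f *: gm); last first.
  by rewrite addrAC !subrK.
apply: von_neumann; rewrite !dotpE ?al_gp ?al_gm ?be_gp ?be_gm; ring.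
Qed.

Lemma green_symop f h : symop_dom f ->
  dot (Astar h) (val f) = dot (val h) (Astar f).
Proof. by move=> f0; rewrite dotC -(symop_dom_green _ h f0) -dotC. Qed.

(** The components in the domain of [A0] drop out by adjointness. The vectors g_+ and g_- need not
    be orthogonal in [H], but their cross terms cancel, and the diagonal terms give 2i / 2 and - 2i
    / 2. *)
Lemma green f h : dot (Astar f) (val h) - dot (val f) (Astar h) =
  'i * (al f * (al h)^* - be f * (be h)^*).
Proof.
have [f0 f0A fE] := von_neumann_decomposition f.
have [h0 h0A hE] := von_neumann_decomposition h.
rewrite {1 2}fE; set a := al f; set b := be f.
rewrite !AstarE !valE dotDl (dotDl (Astar f0)) (symop_dom_green _ h f0A).
rewrite !(dotDl, dotZl).
have gpgm : dot (val gm) (val gp) = (dot (val gp) (val gm))^* by rewrite dotC.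
have ->: dot (Astar gp) (val h) = dot (val gp) (Astar h) + 'i * (al h)^*.
  rewrite {1 2}hE !AstarE !valE !(dotDr, dotZr) (green_symop _ _ h0A).
  rewrite Astar_gp Astar_gm !dotE dot_gp rmorphN /= !conjCi.
  by field.
have ->: dot (Astar gm) (val h) = dot (val gm) (Astar h) - 'i * (be h)^*.
  rewrite {1 2}hE !AstarE !valE !(dotDr, dotZr) (green_symop _ _ h0A).
  rewrite Astar_gp Astar_gm !dotE dot_gm rmorphN /= !conjCi.
  by field.
ring.
Qed.

Lemma hminus_symop (phi : Hminus A0) f : (forall h, symop_dom h -> phi h = 0) ->
  phi f = (al f)^* * phi gp + (be f)^* * phi gm.
Proof.
move=> phi0; have [h h0 {1}->] := von_neumann_decomposition f.
by rewrite !hminusDr !hminusZr phi0 // add0r.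
Qed.

Lemma symop_dom_dense (w : H) :
  (forall h, symop_dom h -> dot w (val h) = 0) -> w = 0.
Proof.
move=> w0; apply: (dense_orth (@symop_dense _ _ A0)) => x [y Axy].
have [f fx fy] := symop_Hplus _ _ Axy.
rewrite dotC -fx w0 ?rmorph0 //.
by rewrite /symop_dom fx fy.
Qed.

(* The restriction of A^* to the line al : be = d : c of the deficiency space. *)
Definition ext c d : set (H * H) := [set p | exists u : Hplus A0,
  [/\ val u = p.1, Astar u = p.2 & c * al u = d * be u]].

Lemma ext_Hplus c d u : ext c d (val u, Astar u) <-> c * al u = d * be u.
Proof.
split=> [[v [/= /val_inj -> _ //]]|e]; by exists u.
Qed.

Lemma ext_sub_adj c d : ext c d `<=` adj A0.
Proof. by move=> [x y] [u [/= <- <- _]]; exact: AstarP. Qed.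

Lemma symop_sub_ext c d : A0 `<=` ext c d.
Proof.
move=> [x y] Axy; have [u ux uy] := symop_Hplus _ _ Axy.
have u0 : symop_dom u by rewrite /symop_dom ux uy.
by exists u; split=> //; rewrite al_symop // be_symop // !mulr0.
Qed.

Lemma ext_operator c d : operator (ext c d).
Proof.
split.
- by exists 0; split; rewrite ?Astar0 //= -(scale0r 0) !dotpZl !mul0r !mulr0.
- move=> e [x y] [x' y'] [u [/= <- <- Eu]] [v [/= <- <- Ev]].
  exists (e *: u + v); split=> //; first by rewrite AstarD AstarZ.
  move: Eu Ev; rewrite !dotpE; move: (al u) (be u) (al v) (be v).
  by move=> a b a' b' Eu Ev; rewrite !mulrDr !(mulrCA _ e) Eu Ev.
- by move=> f x y [u [/= <- <- _]] [v [/= /val_inj -> <- _]].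
Qed.

(** Modulo the domain of [A0], [ext c d] is spanned by d g_+ + c g_-; by [green], its adjoint
    consists of the [h] with d conj(al h) = c conj(be h). *)
Lemma adj_ext c d : c != 0 -> adj (ext c d) = ext d^* c^*.
Proof.
move=> c0; apply/seteqP; split=> [[x y] xy|[x y] [h [/= <- <- E]]].
  have /adj_Hplus[h hx hy] : adj A0 (x, y).
    by move=> q /(@symop_sub_ext c d)/xy.
  exists h; split=> //; pose u := d *: gp + c *: gm.
  have [ua ub] : al u = d /\ be u = c.
    by rewrite !dotpE al_gp al_gm be_gp be_gm; split; ring.
  have /xy/= : ext c d (val u, Astar u) by apply/ext_Hplus; rewrite ua ub mulrC.
  rewrite -hx -hy => /eqP; rewrite -subr_eq0 green ua ub mulf_eq0.
  rewrite (negbTE (neq0Ci _)) subr_eq0.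
  by move=> /eqP/(congr1 Num.conj); rewrite !rmorphM /= !conjCK.
move=> [x' y'] [u [/= <- <- E']]; apply/eqP; rewrite -subr_eq0 green mulf_eq0.
apply/orP; right; rewrite -(mulrI_eq0 _ (mulfI c0)) mulrBr mulrA E'.
have := congr1 Num.conj E; rewrite !rmorphM /= !conjCK => Eh.
by rewrite -mulrA mulrCA Eh; apply/eqP; ring.
Qed.

Lemma ext_closed c d : d != 0 -> closed (ext c d).
Proof.
move=> d0; have -> : ext c d = adj (ext d^* c^*).
  by rewrite adj_ext ?conjC_eq0 // !conjCK.
exact: adj_closed.
Qed.

Lemma ext_self_adjoint c : c != 0 -> c^* = c -> self_adjoint (ext c c).
Proof. by move=> c0 cR; split; [exact: ext_operator|rewrite adj_ext // cR]. Qed.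

(** [green] against g_+ + g_- forces al = be on [A]. Both operators are self-adjoint, so the
    inclusion is an equality. *)
Lemma self_adjoint_extensionE (A : set (H * H)) :
  self_adjoint_extension A0 A -> dom A (val gp + val gm) -> A = ext 1 1.
Proof.
move=> [A0A [Aop adjA]] [w Aw].
have AadjA0 : A `<=` adj A0 by rewrite -adjA => p Ap q /A0A/Ap.
have sub : A `<=` ext 1 1.
  move=> [x y] Axy; have [h hx hy] := adj_Hplus _ _ (AadjA0 _ Axy).
  have [u ux uy] := adj_Hplus _ _ (AadjA0 _ Aw).
  exists h; split=> //; move: Axy; rewrite -adjA => /(_ _ Aw) /= /eqP.
  have uE : u = gp + gm by exact/val_inj.
  rewrite {}uE in ux uy.
  rewrite -ux -uy -hx -hy -subr_eq0 green !dotpE al_gp al_gm be_gp be_gm.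
  rewrite mulf_eq0 (negbTE (neq0Ci _)) add0r addr0 !mul1r subr_eq0 /=.
  by move=> /eqP/(congr1 Num.conj); rewrite !conjCK.
apply/seteqP; split=> // p.
have [_ e] := ext_self_adjoint 1 (oner_neq0 _) (rmorph1 _).
by rewrite -{1}e => ep; rewrite -adjA => q /sub/ep.
Qed.


(** The boundary form vanishes when al = be, so [green] leaves (z - conj z) |u|^2 = 0. *)
Lemma ext_eigen0 z u : complex.Im z != 0 -> Astar u = z *: val u ->
  al u = be u -> u = 0.
Proof.
move=> z0 uz ab; have := green u u; rewrite ab subrr mulr0 uz !dotE -mulrBl.
move/eqP; rewrite mulf_eq0 => /orP[/eqP zz|/eqP/dot_eq0 u0]; last exact/val_inj.
have /Creal_ImP : z \is Num.real by apply/CrealP/esym/eqP; rewrite -subr_eq0 zz.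
by rewrite -complexIm => -[z0']; rewrite z0' eqxx in z0.
Qed.

(** * Operators from H_+ to H_- *)

(** The annihilator of the domain of [A0]; by [hminus_symop] its elements are determined by their
    values at [gp] and [gm]. *)
Definition vanishing (v : Hminus A0) := forall h, symop_dom h -> v h = 0.

Lemma hminus_ext (u v : Hminus A0) : (forall f, u f = v f) -> u = v.
Proof. by move=> uv; apply/val_inj/funext. Qed.

Lemma embE x f : emb A0 x f = dot x (val f). Proof. by []. Qed.

Lemma embB x y : emb A0 x - emb A0 y = emb A0 (x - y).
Proof. by apply: hminus_ext => f; rewrite embE dotDl dotNl. Qed.

Lemma embZ c x : c *: emb A0 x = emb A0 (c *: x).
Proof. by apply: hminus_ext => f; rewrite embE dotZl. Qed.

Lemma embD x y : emb A0 x + emb A0 y = emb A0 (x + y).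
Proof. by apply: hminus_ext => f; rewrite embE dotDl. Qed.

(** As [A0] is densely defined, [H] meets the annihilator of its domain only in 0. An equation in
    [Hminus] thus splits into its part in [H] and its singular part. *)
Lemma emb_vanishing x v : vanishing v -> emb A0 x = v -> x = 0 /\ v = 0.
Proof.
move=> v0 xv; have x0 : x = 0.
  by apply: symop_dom_dense => h /v0; rewrite -xv.
by split=> //; rewrite -xv x0; apply: hminus_ext => f; rewrite embE dot0l.
Qed.

Lemma vanishingZ c v : vanishing v -> vanishing (c *: v).
Proof. by move=> v0 h /v0; rewrite hminusZ => ->; rewrite mulr0. Qed.

Lemma emb_scale_vanishing x c v : vanishing v -> v != 0 ->
  emb A0 x + c *: v = 0 -> x = 0 /\ c = 0.
Proof.
move=> vv v0 /eqP; rewrite addr_eq0 -scaleNr => /eqP.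
move=> /(emb_vanishing _ _ (vanishingZ (- c) _ vv))[-> /eqP].
by rewrite scaler_eq0 oppr_eq0 (negbTE v0) orbF => /eqP ->.
Qed.

(** B f lies in [H] exactly when the coefficient of [v] is zero. *)
Lemma quasi_kernel_ext (B : biop A0) c d v : vanishing v -> v != 0 ->
  (forall f, B f = emb A0 (Astar f) + (c * al f - d * be f) *: v) ->
  quasi_kernel B = ext c d.
Proof.
move=> vv v0 BE; apply/seteqP; split=> [[x y] [u /= <-]|[x y] [u [/= <- <- E]]].
  rewrite BE => /eqP; rewrite -subr_eq0 addrAC embB => /eqP.
  move=> /(emb_scale_vanishing _ _ _ vv v0)[/eqP + /eqP].
  by rewrite !subr_eq0 => /eqP yE /eqP E; exists u.
by exists u => //=; rewrite BE E subrr scale0r addr0.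
Qed.

(** [biop_resolvent] picks some solution, so injectivity identifies it with any given one. *)
Lemma biop_resolventE (B : biop A0) z (k : Hminus A0) x :
  (forall y, B y - z *: emb A0 (val y) = 0 -> y = 0) ->
  B x - z *: emb A0 (val x) = k -> biop_resolvent B z k = x.
Proof.
move=> B0 Bx; rewrite /biop_resolvent; case: xgetP => [y _ /= By|/(_ x)/(_ Bx) //].
apply/eqP; rewrite -subr_eq0; apply/eqP/B0.
have -> : B (y - x) = B y - B x.
  by rewrite addrC -scaleN1r biop_linear scaleN1r addrC.
rewrite valD valN -embB scalerBr.
transitivity (B y - z *: emb A0 (val y) - (B x - z *: emb A0 (val x))).
  by rewrite !opprD !opprK addrACA.
by rewrite By Bx subrr.
Qed.

(** On the kernel of A^* - z only the singular part of B - z survives; injectivity is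
    [ext_eigen0]. *)
Lemma biop_resolvent_diff (B : biop A0) z v x : complex.Im z != 0 ->
  vanishing v -> v != 0 ->
  (forall f, B f = emb A0 (Astar f) + (al f - be f) *: v) ->
  Astar x = z *: val x -> biop_resolvent B z ((al x - be x) *: v) = x.
Proof.
move=> z0 vv v0 BE xz; apply: biop_resolventE => [y|].
  rewrite BE embZ addrAC embB => /(emb_scale_vanishing _ _ _ vv v0)[/eqP + /eqP].
  by rewrite !subr_eq0 => /eqP yz /eqP; exact: (ext_eigen0 _ _ z0 yz).
rewrite BE embZ addrAC embB xz subrr; apply: hminus_ext => f.
by rewrite hminusD embE dot0l add0r.
Qed.

Lemma biop_ext (B C : biop A0) : (forall f, B f = C f) -> B = C.
Proof. by move=> BC; apply/val_inj/funext. Qed.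

Lemma biop_adjE (B : biop A0) f h : biop_adj B f h = (B h f : R[i])^*.
Proof. by []. Qed.

Lemma re_biopE (B : biop A0) f h : re_biop B f h = 2^-1 * (B f h + (B h f)^*).
Proof. by []. Qed.

Lemma im_biopE (B : biop A0) f h :
  im_biop B f h = (2 * 'i)^-1 * (B f h - (B h f)^*).
Proof. by []. Qed.

Lemma biop_re_im (B : biop A0) f : B f = re_biop B f + 'i *: im_biop B f.
Proof.
apply: hminus_ext => h; rewrite hminusD re_biopE (hminusZ (Num.imaginary)) im_biopE.
by field; rewrite neq0Ci.
Qed.

Lemma re_biop_adj (B : biop A0) : biop_adj (re_biop B) = re_biop B.
Proof.
apply: biop_ext => f; apply: hminus_ext => h.
rewrite biop_adjE !re_biopE rmorphM rmorphD /= conjCK fmorphV rmorph_nat.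
by rewrite [_^* + _]addrC.
Qed.

Lemma quasi_kernel_extends (B : biop A0) (S : set (H * H)) :
  S `<=` quasi_kernel B -> biop_extends B S.
Proof. by move=> SB f h /SB[u]; exists u. Qed.

(** * The explicit state-space operator, its adjoint, and its real and imaginary parts *)

Variables (phi psi : Hminus A0).
Hypotheses (hphi : riesz_berezansky phi = gp) (hpsi : riesz_berezansky psi = gm).

(** The condition on [u] excludes the default value 0 of [xget]. *)
Lemma riesz_berezanskyP (v : Hminus A0) u : riesz_berezansky v = u -> u != 0 ->
  forall f, v f = (dotp f u)^*.
Proof.
rewrite /riesz_berezansky; case: xgetP => [w _ wP <- _ f|_ <-]; last by rewrite eqxx.
by rewrite -wP /pairing conjCK.
Qed.

Lemma phiE f : phi f = (al f)^*.
Proof.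
apply: (riesz_berezanskyP _ _ hphi); apply: contraTneq (oner_neq0 R[i]) => g0.
by rewrite -ngp g0 normr0 eqxx.
Qed.

Lemma psiE f : psi f = (be f)^*.
Proof.
apply: (riesz_berezanskyP _ _ hpsi); apply: contraTneq (oner_neq0 R[i]) => g0.
by rewrite -ngm g0 normr0 eqxx.
Qed.

Lemma phipsiE f : (phi + psi) f = (al f + be f)^*.
Proof. by rewrite hminusD phiE psiE [RHS]rmorphD. Qed.

Lemma phipsi_vanishing : vanishing (phi + psi).
Proof. by move=> f f0; rewrite phipsiE al_symop // be_symop // addr0 rmorph0. Qed.

Lemma phipsi_neq0 : phi + psi != 0.
Proof.
apply: contraTneq (oner_neq0 R[i]) => e; have := phipsiE gp.
by rewrite e al_gp be_gp addr0 rmorph1 => <-; rewrite eqxx.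
Qed.

Lemma conj_real (x : R) : (x%:C : R[i])^* = x%:C.
Proof. by apply/CrealP/complex_realP; exists x. Qed.

Lemma conj_comb (a : R) (x y : R[i]) :
  ((1 - a%:C) * x^* - (1 + a%:C) * y^*)^* = (1 - a%:C) * x - (1 + a%:C) * y.
Proof.
by rewrite rmorphB !rmorphM !(rmorphB, rmorphD) /= !conjCK !conj_real !rmorph1.
Qed.

Definition canonical_state (a : R) : biop A0 := Astar_biop A0 -
  ('i / 2) *: rank1 ((1 - a%:C) *: phi - (1 + a%:C) *: psi) (phi + psi).

Lemma canonical_stateE a f : canonical_state a f = emb A0 (Astar f) +
  ((1 - a%:C) * al f - (1 + a%:C) * be f) *: (- ('i / 2) *: (phi + psi)).
Proof.
rewrite /canonical_state; apply: hminus_ext => h.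
rewrite -[LHS]/(emb A0 (Astar f) h - ('i / 2) *
  (((1 - a%:C) * phi f - (1 + a%:C) * psi f)^* * (phi + psi) h)).
rewrite [RHS]hminusD !hminusZ phiE psiE conj_comb; ring.
Qed.

(** [green] trades (f, A^* h) for (A^* f, h); the net effect of the adjoint is to replace [a] by -
    a. *)
Lemma canonical_state_adjE a f : biop_adj (canonical_state a) f = emb A0 (Astar f) +
  ((1 + a%:C) * al f - (1 - a%:C) * be f) *: (- ('i / 2) *: (phi + psi)).
Proof.
apply: hminus_ext => h; rewrite biop_adjE canonical_stateE !hminusD !hminusZ.
rewrite !phipsiE !embE; have := green f h; rewrite (dotC (Astar h)).
move: (dot (Astar h) _) (dot (Astar f) _) (al f) (be f) (al h) (be h).
move=> p q x y x' y' /(canRL (subrK _)) ->.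
rewrite !(rmorphB, rmorphD, rmorphM, rmorphN) /= !conjCK conjCi.
rewrite fmorphV rmorph_nat !conj_real !rmorph1.
by field.
Qed.

Lemma re_canonicalE a f : re_biop (canonical_state a) f = emb A0 (Astar f) +
  (al f - be f) *: (- ('i / 2) *: (phi + psi)).
Proof.
apply: hminus_ext => h; rewrite re_biopE -biop_adjE canonical_stateE canonical_state_adjE.
by rewrite !hminusD !hminusZ; field.
Qed.

Lemma im_canonicalE a f : im_biop (canonical_state a) f =
  (a%:C / 2 * (al f + be f)) *: (phi + psi).
Proof.
apply: hminus_ext => h; rewrite im_biopE -biop_adjE canonical_stateE canonical_state_adjE.
by rewrite !hminusD !hminusZ; field; rewrite neq0Ci.
Qed.

Lemma half_i_neq0 : - ('i / 2) != 0 :> R[i].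
Proof. by rewrite oppr_eq0 mulf_neq0 ?neq0Ci ?invr_eq0 ?pnatr_eq0. Qed.

Lemma halfphipsi_vanishing : vanishing (- ('i / 2) *: (phi + psi)).
Proof. exact/vanishingZ/phipsi_vanishing. Qed.

Lemma halfphipsi_neq0 : - ('i / 2) *: (phi + psi) != 0.
Proof. by rewrite scaler_eq0 negb_or half_i_neq0 phipsi_neq0. Qed.

Lemma quasi_kernel_canonical a :
  quasi_kernel (canonical_state a) = ext (1 - a%:C) (1 + a%:C).
Proof.
apply: quasi_kernel_ext halfphipsi_vanishing halfphipsi_neq0 _.
exact: canonical_stateE.
Qed.

Lemma quasi_kernel_canonical_adj a :
  quasi_kernel (biop_adj (canonical_state a)) = ext (1 + a%:C) (1 - a%:C).
Proof.
apply: quasi_kernel_ext halfphipsi_vanishing halfphipsi_neq0 _.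
exact: canonical_state_adjE.
Qed.

Lemma quasi_kernel_canonical_re a :
  quasi_kernel (re_biop (canonical_state a)) = ext 1 1.
Proof.
apply: quasi_kernel_ext halfphipsi_vanishing halfphipsi_neq0 _ => f.
by rewrite !mul1r re_canonicalE.
Qed.

Lemma Im_dot_Astar u : (complex.Im (dot (Astar u) (val u)))%:C =
  (al u * (al u)^* - be u * (be u)^*) / 2.
Proof.
have := green u u; rewrite (dotC (Astar u)) complexIm ImE => E.
rewrite -[X in X / 2 = _]opprK -mulrN opprB E mulrA -expr2 sqrCi.
by rewrite mulN1r opprK.
Qed.

(** * The L-system with state-space operator [canonical_state a] *)

Section CanonicalOperator.
Variables (a : R) (a1 : 1 < a).

Lemma aC1 : 1 < a%:C :> R[i].
Proof. by rewrite -[1]/((1 : R)%:C) ltcR. Qed.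

Lemma subaC_neq0 : 1 - a%:C != 0 :> R[i].
Proof. by rewrite subr_eq0 lt_eqF // aC1. Qed.

Lemma addaC_neq0 : 1 + a%:C != 0 :> R[i].
Proof. by rewrite gt_eqF // addr_gt0 // (lt_trans ltr01 aC1). Qed.

Local Notation T := (ext (1 - a%:C) (1 + a%:C)).

Lemma adj_canonical : adj T = ext (1 + a%:C) (1 - a%:C).
Proof.
by rewrite adj_ext ?subaC_neq0 // rmorphB rmorphD rmorph1 /= conj_real.
Qed.

(** On [T], [be] is (1 - a) / (1 + a) times [al], so the form is 2a / (1 + a)^2 |al|^2. *)
Lemma canonical_dissipative : dissipative T.
Proof.
move=> x y [u [/= <- <- E]]; rewrite -lecR Im_dot_Astar.
have -> : be u = (1 - a%:C) / (1 + a%:C) * al u.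
  by rewrite mulrAC E mulrAC divff ?mul1r ?addaC_neq0.
have -> : (al u * (al u)^* - (1 - a%:C) / (1 + a%:C) * al u *
   ((1 - a%:C) / (1 + a%:C) * al u)^*) / 2 =
   2 * a%:C / (1 + a%:C) ^+ 2 * (al u * (al u)^*).
  move: (al u) => s.
  rewrite !rmorphM fmorphV rmorphB rmorphD rmorph1 /= !conj_real.
  by field; rewrite addaC_neq0.
have a0 := lt_trans ltr01 aC1.
by rewrite mulr_ge0 ?mul_conjC_ge0 // divr_ge0 ?mulr_ge0 ?exprn_ge0 ?addr_ge0 // ltW.
Qed.

Lemma canonical_quasi_self_adjoint : quasi_self_adjoint_extension A0 T.
Proof.
split; [exact: ext_operator| |exact: symop_sub_ext|exact: ext_sub_adj].
rewrite /symmetric_operator adj_canonical => sub.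
(* This vector lies in the domain of [T]; symmetry would give (1 + a)^2 = (1 - a)^2. *)
pose u := (1 + a%:C) *: gp + (1 - a%:C) *: gm.
have ua : al u = 1 + a%:C by rewrite !dotpE al_gp al_gm; ring.
have ub : be u = 1 - a%:C by rewrite !dotpE be_gp be_gm; ring.
have /sub/ext_Hplus : T (val u, Astar u) by apply/ext_Hplus; rewrite ua ub mulrC.
rewrite ua ub => /eqP; rewrite -subr_eq0.
have -> : (1 + a%:C) * (1 + a%:C) - (1 - a%:C) * (1 - a%:C) = 4 * a%:C :> R[i].
  by ring.
by rewrite gt_eqF // mulr_gt0 // (lt_trans ltr01 aC1).
Qed.

(** Dissipativity bounds T + i below. In the adjoint kernel [be] vanishes, hence so does [al]. *)
Lemma canonical_resolvent_set : resolvent_set T !=set0.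
Proof.
exists (- 'i); apply: resolvent_setP; first exact: ext_operator.
- exact/ext_closed/addaC_neq0.
- exact/dissipative_bounded_below/canonical_dissipative.
rewrite adj_canonical rmorphN /= conjCi opprK => n [h [/= <- hi E]].
have b0 := be_defect _ hi; have /eqP : (1 + a%:C) * al h = 0 by rewrite E b0 mulr0.
rewrite mulf_eq0 (negbTE addaC_neq0) /= => /eqP a0.
have -> : h = 0 by apply: (ext_eigen0 'i); rewrite ?a0 ?b0 // -complexiE oner_neq0.
by [].
Qed.

Lemma canonical_star_extension : star_extension T (canonical_state a).
Proof.
split; [exact: canonical_quasi_self_adjoint|exact: canonical_resolvent_set| | |].
- split; first exact: symop_sub_ext.
  by apply: quasi_kernel_extends; rewrite quasi_kernel_canonical.
- rewrite adj_canonical; split; first exact: symop_sub_ext.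
  by apply: quasi_kernel_extends; rewrite quasi_kernel_canonical_adj.
- split; last first.
    rewrite quasi_kernel_canonical_re.
    by apply: ext_self_adjoint; rewrite ?oner_neq0 ?rmorph1.
  split; last exact: re_biop_adj.
  apply: quasi_kernel_extends; rewrite quasi_kernel_canonical_re.
  exact: symop_sub_ext.
Qed.


Lemma half_sqrtM : a%:C / 2 = (Num.sqrt (a / 2))%:C * (Num.sqrt (a / 2))%:C :> R[i].
Proof.
rewrite -rmorphM -expr2 sqr_sqrtr ?divr_ge0 ?(ltW (lt_trans ltr01 a1)) //.
by rewrite rmorphM fmorphV rmorph_nat.
Qed.

Lemma canonical_channelE f : im_biop (canonical_state a) f =
  line_channel ((Num.sqrt (a / 2))%:C *: (phi + psi))
    (channel_adj (line_channel ((Num.sqrt (a / 2))%:C *: (phi + psi))) f).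
Proof.
rewrite im_canonicalE /channel_adj /line_channel scale1r scalerA; congr (_ *: _).
rewrite /pairing hminusZ phipsiE half_sqrtM; move: (al f + be f) => s.
by rewrite rmorphM /= conjCK conj_real; ring.
Qed.

Definition canonical_system : Lsystem A0 :=
  LSystem hdef canonical_quasi_self_adjoint canonical_dissipative
    canonical_resolvent_set canonical_star_extension
    (channel := line_channel ((Num.sqrt (a / 2))%:C *: (phi + psi)))
    canonical_channelE.

(** * Impedance, entropy and dissipation for the explicit state-space operator *)

Section System.
(** Only the modulus of [w] is fixed: the converse recovers the channel up to a unimodular factor,
    and the same computations then serve both halves of the theorem. *)
Variables (Theta : Lsystem A0) (w : R[i]).
Hypotheses (hstate : state Theta = canonical_state a)
  (hchannel : channel Theta 1 = w *: (phi + psi))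
  (hw : w * w^* = a%:C / 2) (hmain : main Theta = T).

Lemma channel_adjE f : channel_adj (channel Theta) f = w^* * (al f + be f).
Proof.
rewrite /channel_adj /pairing hchannel hminusZ phipsiE.
by move: (al f + be f) => s; rewrite rmorphM /= conjCK.
Qed.

(** The normalization of [x] says that (Re AA - z) x = K 1. *)
Lemma impedance_eigen z x : complex.Im z != 0 -> Astar x = z *: val x ->
  - ('i / 2) * (al x - be x) = w -> impedance Theta z = w^* * (al x + be x).
Proof.
move=> z0 xz xw; rewrite /impedance hchannel hstate.
have <- : (al x - be x) *: (- ('i / 2) *: (phi + psi)) = w *: (phi + psi).
  by rewrite scalerA mulrC xw.
rewrite (biop_resolvent_diff _ _ _ _ z0 halfphipsi_vanishing halfphipsi_neq0
  (re_canonicalE a) xz).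
exact: channel_adjE.
Qed.

Lemma transferE : transfer Theta (- 'i) = (1 - a%:C) / (1 + a%:C).
Proof.
(* The solution of (AA + i) x = K 1 is a multiple of g_-; [b] solves (1 + a) b i / 2 = w. *)
pose b := - (2 * 'i * w / (1 + a%:C)).
have x0 : al (b *: gm) = 0 by rewrite dotpZl al_gm mulr0.
have x1 : be (b *: gm) = b by rewrite dotpZl be_gm mulr1.
rewrite /transfer hchannel hstate (biop_resolventE _ _ _ (b *: gm)).
- rewrite channel_adjE x0 x1 add0r mulrA.
  have -> : 2 * 'i * w^* * b = - ('i ^+ 2) * (4 * (w * w^*)) / (1 + a%:C).
    by rewrite /b; field; rewrite addaC_neq0.
  by rewrite hw sqrCi; field; rewrite addaC_neq0.
- move=> y; rewrite canonical_stateE embZ addrAC embB.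
  case/(emb_scale_vanishing _ _ _ halfphipsi_vanishing halfphipsi_neq0).
  move=> /eqP + /eqP.
  rewrite !subr_eq0 => /eqP yi /eqP; rewrite (al_defect _ yi) mulr0 => /esym/eqP.
  rewrite mulf_eq0 (negbTE addaC_neq0) /= => /eqP y1.
  by apply: (ext_eigen0 _ _ ImNi yi); rewrite y1 (al_defect _ yi).
rewrite canonical_stateE embZ addrAC embB x0 x1 AstarZ Astar_gm valZ scalerA mulrC.
rewrite -scalerA subrr scalerA.
have -> : ((1 - a%:C) * 0 - (1 + a%:C) * b) * - ('i / 2) = - ('i ^+ 2) * w.
  by rewrite /b; field; rewrite addaC_neq0.
rewrite sqrCi opprK mul1r; apply: hminus_ext => f.
by rewrite hminusD embE dot0l add0r.
Qed.

(** Since a > 1, the transfer value (1 - a) / (1 + a) is nonzero with modulus (a - 1) / (a + 1), so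
    the entropy is finite. *)
Lemma c_entropyE : c_entropy Theta = (ln (a + 1) - ln (a - 1))%:E.
Proof.
have a0 : 0 < a := lt_trans ltr01 a1.
have am : 0 < a - 1 by rewrite subr_gt0.
have ap : 0 < a + 1 by rewrite addr_gt0.
have r0 : 0 < (a - 1) / (a + 1) by rewrite divr_gt0.
have E : complex.Re `|transfer Theta (- 'i)| = (a - 1) / (a + 1).
  have -> : transfer Theta (- 'i) = (- ((a - 1) / (a + 1)))%:C.
    rewrite transferE rmorphN rmorphM fmorphV !(rmorphD, rmorphN, rmorph1) /=.
    by rewrite -mulNr opprB (addrC 1 a%:C).
  by rewrite normc_def /= expr0n addr0 sqrrN sqrtr_sqr gtr0_norm.
rewrite /c_entropy E gt_eqF // lnM ?posrE ?invr_gt0 // lnV ?posrE //.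
by rewrite opprD opprK addrC.
Qed.

Lemma sqrtC2_conj : sqrtC 2 * (sqrtC 2)^* = 2 :> R[i].
Proof. by rewrite geC0_conj ?sqrtC_ge0 ?ler0n // -expr2 sqrtCK. Qed.

Lemma app_ext c d u : c * al u = d * be u -> app (ext c d) (val u) = Astar u.
Proof.
move=> /ext_Hplus uT; have [_ _ fT] := ext_operator c d.
by apply: (fT (val u)) => //; apply: Defs.appP; exists (Astar u).
Qed.

(** [p] and [q] are the phases of an arbitrary normalized basis relative to [gp], [gm]. Squared
    moduli in the equation of [T] remove them and give k^2 = (1 - a)^2 / (1 + a)^2; the dissipation
    is 1 - k^2. *)
Lemma dissipation_value p q (k : R[i]) (u : Hplus A0) :
  u = sqrtC 2 *: (p *: gp) - k *: (sqrtC 2 *: (q *: gm)) ->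
  p * p^* = 1 -> q * q^* = 1 -> k^* = k ->
  (1 - a%:C) * al u = (1 + a%:C) * be u ->
  complex.Im (dot (app T (val u)) (val u)) = 4 * a / (1 + a) ^+ 2.
Proof.
move=> uE p1 q1 kr E; apply: (@complexI R).
rewrite app_ext // Im_dot_Astar; move: E.
have -> : (4 * a / (1 + a) ^+ 2)%:C = 4 * a%:C / (1 + a%:C) ^+ 2 :> R[i].
  by rewrite !rmorphM fmorphV rmorphXn rmorph_nat rmorphD rmorph1.
have -> : al u = sqrtC 2 * p by rewrite uE !dotpE al_gp al_gm; ring.
have -> : be u = - (k * sqrtC 2 * q) by rewrite uE !dotpE be_gp be_gm; ring.
move=> E.
have := congr1 (fun x => x * x^*) E.
rewrite !(rmorphM, rmorphN, rmorphB, rmorphD) /= !conj_real !rmorph1 kr.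
have -> : (1 - a%:C) * (sqrtC 2 * p) * ((1 - a%:C) * ((sqrtC 2)^* * p^*)) =
  (1 - a%:C) ^+ 2 * (sqrtC 2 * (sqrtC 2)^*) * (p * p^*) by ring.
have -> : (1 + a%:C) * - (k * sqrtC 2 * q) *
    ((1 + a%:C) * - (k * (sqrtC 2)^* * q^*)) =
  (1 + a%:C) ^+ 2 * k ^+ 2 * (sqrtC 2 * (sqrtC 2)^*) * (q * q^*) by ring.
have -> : sqrtC 2 * p * ((sqrtC 2)^* * p^*) -
    - (k * sqrtC 2 * q) * - (k * (sqrtC 2)^* * q^*) =
  (sqrtC 2 * (sqrtC 2)^*) * (p * p^*) -
    k ^+ 2 * (sqrtC 2 * (sqrtC 2)^*) * (q * q^*) by ring.
rewrite sqrtC2_conj p1 q1 !mulr1 => /(mulIf (_ : 2 != 0)) kE.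
have {}kE : k ^+ 2 = (1 - a%:C) ^+ 2 / (1 + a%:C) ^+ 2.
  by rewrite kE ?pnatr_eq0 // mulrAC divff ?mul1r // expf_neq0 // addaC_neq0.
by rewrite kE; field; rewrite addaC_neq0.
Qed.

Lemma unit_multiple (h u : Hplus A0) t :
  `|h| = 1 -> `|u| = 1 -> val u = t *: val h -> u = t *: h /\ t * t^* = 1.
Proof.
move=> h1 u1 ut; have {}ut : u = t *: h by exact/val_inj.
split=> //; rewrite -normCK; move: u1; rewrite ut normrZ h1 mulr1 => ->.
by rewrite expr1n.
Qed.

Lemma dissipation_values_main :
  dissipation_values A0 (main Theta) = [set 4 * a / (1 + a) ^+ 2].
Proof.
rewrite hmain; apply/seteqP; split=> [d [gp' [gm' [k]]]|_ ->] /=.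
  move=> [[dp np] [dm nm] [_ /andP[k0 _]] dy ->].
  have [p pE] := defect_gp _ dp; have [q qE] := defect_gm _ dm.
  have [{}pE p1] := unit_multiple _ _ _ ngp np pE.
  have [{}qE q1] := unit_multiple _ _ _ ngm nm qE.
  pose u := sqrtC 2 *: gp' - k *: (sqrtC 2 *: gm').
  have [w' [v [/= vu _ E]]] := dy.
  have vE : v = u by exact/val_inj.
  rewrite vE in E; apply: (dissipation_value p q k u) => //; last exact: geC0_conj.
  by rewrite /u pE qE.
(* The parameter for the given basis, from (1 - a) al = (1 + a) be with be / al = - k. *)
pose k : R[i] := (a%:C - 1) / (1 + a%:C).
have a0 : 0 < 1 + a%:C :> R[i] by rewrite addr_gt0 // (lt_trans ltr01 aC1).
have k0 : 0 <= k by rewrite divr_ge0 ?(ltW a0) // subr_ge0 ltW // aC1.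
have k1 : k < 1.
  by rewrite ltr_pdivrMr // mul1r addrC ltrD2r (lt_trans _ ltr01) // oppr_lt0.
pose u := sqrtC 2 *: (1 *: gp) - k *: (sqrtC 2 *: (1 *: gm)).
have E : (1 - a%:C) * al u = (1 + a%:C) * be u.
  rewrite /u !dotpE al_gp al_gm be_gp be_gm /k.
  by field; rewrite addaC_neq0.
exists gp, gm, k; split=> //.
- by rewrite ger0_norm // k0 (ltW k1).
- exists (Astar u); have := E => /ext_Hplus; rewrite /u !scale1r; exact.
- have := dissipation_value 1 1 k u erefl _ _ (geC0_conj k0) E.
  by rewrite rmorph1 mulr1 /u !scale1r => <-.
Qed.

Lemma dissipationE : dissipation_coefficient A0 (main Theta) = 4 * a / (1 + a) ^+ 2.
Proof.
rewrite /dissipation_coefficient dissipation_values_main.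
by case: xgetP => [y _ ->|/(_ (4 * a / (1 + a) ^+ 2))[]].
Qed.

Lemma impedance_weyl (g : H) z : defect A0 'i g -> `|g| = 1 -> 0 < complex.Im z ->
  impedance Theta z = a%:C * weyl_titchmarsh (ext 1 1) g z.
Proof.
move=> gi g1 zpos; have z0 : complex.Im z != 0 by rewrite gt_eqF.
have [t gE] := defect_gp _ gi.
have tt : t * t^* = 2.
  have := dot_norm g; rewrite g1 expr1n gE !dotE dot_gp mulrA => tt2.
  by rewrite -[LHS](divfK (_ : 2 != 0)) ?pnatr_eq0 // tt2 mul1r.
have t0 : t != 0.
  by apply: contra_eq_neq tt => ->; rewrite mul0r eq_sym pnatr_eq0.
have sa : self_adjoint (ext 1 1).
  by apply: ext_self_adjoint; rewrite ?oner_neq0 ?rmorph1.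
have [_ [u [/= <- ux ab]] ->] :=
  weyl_titchmarsh_resolvent _ g z sa.1 (self_adjoint_resolvent _ _ sa z0).
rewrite !mul1r in ab.
pose G := t *: gp; have GE : val G = g by rewrite gE.
have aG : al G = t by rewrite dotpZl al_gp mulr1.
have bG : be G = 0 by rewrite dotpZl be_gp mulr0.
have GA : Astar G = 'i *: g by rewrite AstarZ Astar_gp scalerA mulrC -scalerA -gE.
clearbody G.
(* Up to a scalar, n is the solution of (Re AA - z) n = K 1. *)
pose n := G + (z - 'i) *: u.
have nz : Astar n = z *: val n.
  rewrite /n AstarD AstarZ ux GA valD (valZ _ u) GE; apply: eq_dot => x.
  by rewrite !dotE; ring.
have an : al n = t + (z - 'i) * al u by rewrite !dotpE aG.
have bn : be n = (z - 'i) * al u by rewrite !dotpE bG add0r ab.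
(* This expresses al u through (u, g), the quantity occurring in the Weyl-Titchmarsh function. *)
have := green u G; rewrite aG bG rmorph0 mulr0 subr0 ux GA GE !dotE conjCi.
rewrite dot_norm g1 => gr.
(* As al n - be n = t, this factor makes - (i / 2) (al - be) equal to [w]. *)
pose s := 2 * 'i * w / t.
rewrite (impedance_eigen z (s *: n) z0).
- rewrite !dotpZl an bn; move: gr; rewrite expr1n /s.
  move: (dot (val u) g) (al u) => p x gr.
  have ti : t^-1 = t^* / 2 by rewrite -tt invfM mulrCA divff ?mulr1 // conjC_eq0.
  have -> : z * (1 + z * p) + p = z + (z - 'i) * (1 + z * p - - 'i * p - 1).
    apply/eqP; rewrite -subr_eq0; apply/eqP.
    transitivity (p * (1 + 'i ^+ 2)); first by ring.
    by rewrite sqrCi subrr mulr0.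
  have -> : w^* * (2 * 'i * w / t * (t + (z - 'i) * x) +
      2 * 'i * w / t * ((z - 'i) * x)) =
    2 * 'i * (w * w^*) * (t / t + 2 * (z - 'i) * x * t^-1) by ring.
  by rewrite gr hw divff // ti; field.
- by rewrite AstarZ nz valZ !scalerA mulrC.
- rewrite !dotpZl an bn /s; transitivity (- 'i ^+ 2 * w); first by field; rewrite t0.
  by rewrite sqrCi opprK mul1r.
Qed.

End System.


(** * Recovering the state-space operator *)

Lemma biop_extendsE (B : biop A0) (S : set (H * H)) f w :
  biop_extends B S -> S (val f, w) -> B f = emb A0 w.
Proof. by move=> BS /BS[u uf <-]; rewrite (val_inj uf). Qed.

Lemma quasi_kernelE (B : biop A0) f w :
  quasi_kernel B (val f, w) -> B f = emb A0 w.
Proof. by move=> [u uf <-]; rewrite (val_inj uf). Qed.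

(** B - A^* kills the domain of [A0] and g_+ + g_-, so its value [v] at g_+ determines it. Symmetry
    of [B] compared with [green] then constrains [v]. *)
Lemma re_biop_difference (B : biop A0) : self_adjoint_biextension B ->
  quasi_kernel B = ext 1 1 -> exists v : Hminus A0,
  [/\ vanishing v, v != 0, forall f, B f = emb A0 (Astar f) + (al f - be f) *: v,
     v gp - (v gp)^* = - 'i & v gm = - (v gp)^*].
Proof.
move=> [BA Badj] BQ; have sym f h : B f h = (B h f)^* by rewrite -biop_adjE Badj.
have B0 f : symop_dom f -> B f = emb A0 (Astar f).
  exact: biop_extendsE.
have BD f h : B (f + h) = B f + B h.
  by have := biop_linear B 1 f h; rewrite !scale1r.
have BZ c f : B (c *: f) = c *: B f.
  have := biop_linear B c f 0; rewrite !addr0 => ->.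
  have -> : B 0 = 0 by apply: (addIr (B 0)); rewrite -BD !add0r.
  by rewrite addr0.
pose v := B gp - emb A0 (Astar gp); exists v.
have Bp : B gp = emb A0 (Astar gp) + v by rewrite addrC subrK.
have Bm : B gm = emb A0 (Astar gm) - v.
  have : quasi_kernel B (val (gp + gm), Astar (gp + gm)).
    rewrite BQ; apply/ext_Hplus.
    by rewrite !dotpE al_gp al_gm be_gp be_gm add0r addr0.
  move=> /quasi_kernelE; rewrite BD AstarD -embD Bp => E.
  by apply: (addrI (emb A0 (Astar gp) + v)); rewrite E addrACA subrr addr0.
clearbody v.
have vE f : B f = emb A0 (Astar f) + (al f - be f) *: v.
  have [f0 f0A fE] := von_neumann_decomposition f.
  move: (al f) (be f) fE => x y ->; rewrite !BD !BZ B0 // Bp Bm !AstarD !AstarZ.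
  apply: hminus_ext => h; rewrite !(hminusD, hminusZ, embE, dotE).
  by rewrite -[(- v) h]/(- v h); ring.
have sym' f h : v h * (al f - be f) - (v f * (al h - be h))^* =
    - 'i * (al f * (al h)^* - be f * (be h)^*).
  have := sym f h; rewrite !vE !hminusD !hminusZ !embE.
  have := green f h; rewrite [dot (val f) _]dotC.
  move: (dot _ _) (dot _ _) (al f) (al h) (be f) (be h) (v f) (v h).
  move=> p q x x' y y' vf vh E.
  rewrite rmorphD !rmorphM rmorphB /= => E'.
  rewrite mulNr -E [vh * _]mulrC [_ * vh](canRL (addKr _) E'); ring.
split=> //.
- move=> h h0; have := sym' gp h.
  rewrite al_gp be_gp (al_symop _ h0) (be_symop _ h0) !subrr rmorph0 !mulr0 !rmorph0.
  by rewrite !subr0 mulr1 mulr0.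
- apply/eqP => v0; have := sym' gp gp.
  rewrite v0 !mul0r rmorph0 subrr al_gp be_gp rmorph1 mulr1 mul0r subr0 mulr1.
  by move/esym/eqP; rewrite oppr_eq0 (negbTE (neq0Ci _)).
- have := sym' gp gp.
  by rewrite al_gp be_gp !subr0 !mulr1 rmorph1 rmorph0 mulr0 !subr0 !mulr1.
- have := sym' gp gm.
  rewrite al_gp al_gm be_gp be_gm !rmorph0 !mul0r !mulr0 subrr mulr0 subr0.
  rewrite mulr1 sub0r mulrN1.
  by rewrite rmorphN opprK => /eqP; rewrite addr_eq0 => /eqP.
Qed.

(* Only the value of the impedance at i is needed, where M(i) = i. *)
Lemma state_from_impedance (Theta : Lsystem A0) :
  quasi_kernel (re_biop (state Theta)) = ext 1 1 ->
  impedance Theta 'i = a%:C * 'i ->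
  [/\ state Theta = canonical_state a, main Theta = T &
    exists2 w, channel Theta 1 = w *: (phi + psi) & w * w^* = a%:C / 2].
Proof.
move=> qk imp.
have [[Top Tsym TA TA'] _ [_ ext_state] _ [reSA _]] := Lsystem_state Theta.
set B := re_biop (state Theta) in qk reSA.
have [v [vv v0 BE vp vm]] := re_biop_difference _ reSA qk.
set k := channel Theta 1.
have sE f : state Theta f = B f + ('i * pairing f k) *: k.
  rewrite biop_re_im Lsystem_channel -scalerA; congr (_ + 'i *: _).
  rewrite -[X in channel Theta X](mulr1 (channel_adj (channel Theta) f)).
  by rewrite (linearZ_LR (channel Theta)).
have sT f : main Theta (val f, Astar f) -> state Theta f = emb A0 (Astar f).
  exact: biop_extendsE.
(* On the domain of [A0] both the state-space operator and its real part act as A^*, so (f, k) k =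
   0. *)
have kv : vanishing k.
  move=> f f0; have := sT _ (TA _ f0).
  rewrite sE BE al_symop // be_symop // subrr scale0r addr0.
  rewrite -[RHS]addr0 => /addrI/eqP; rewrite scaler_eq0 mulf_eq0 (negbTE (neq0Ci _)) /=.
  by rewrite /pairing conjC_eq0 => /orP[/eqP //|/eqP ->].
have T_Hplus x y : main Theta (x, y) ->
    exists2 u : Hplus A0, val u = x & Astar u = y.
  by move=> /TA'/adj_Hplus.
(* Otherwise main Theta would be a restriction of ext 1 1, hence symmetric. *)
have [u Tu ab] : exists2 u : Hplus A0, main Theta (val u, Astar u) & al u != be u.
  apply: contrapT => no; apply: Tsym.
  have T1 : main Theta `<=` ext 1 1.
    move=> [x y] Txy; have [u ux uy] := T_Hplus _ _ Txy.
    exists u; split=> //; rewrite !mul1r; apply: contrapT => /eqP ab; apply: no.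
    by exists u; rewrite ?ux ?uy.
  have [_ sa] : self_adjoint (ext 1 1).
    by apply: ext_self_adjoint; rewrite ?oner_neq0 ?rmorph1.
  by move=> p /T1; rewrite -{1}sa => p1 q /T1; exact: p1.
pose l := - ('i * pairing u k) / (al u - be u).
(* At [u] the state-space operator acts as A^*, so (al u - be u) v and i (u, k) k cancel. *)
have vk : v = l *: k.
  have := sT _ Tu; rewrite sE BE -addrA -[RHS]addr0 => /addrI/eqP.
  rewrite addr_eq0 -scaleNr => /eqP E; apply: (scalerI (_ : al u - be u != 0)).
    by rewrite subr_eq0.
  by rewrite E scalerA [(al u - be u) * _]mulrC divfK // subr_eq0.
clearbody l.
have l0 : l != 0 by apply: contraNneq v0 => l0; rewrite vk l0 scale0r.
have kv' : k = l^-1 *: v by rewrite vk scalerA mulVf // scale1r.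
have i0 : complex.Im ('i : R[i]) != 0 by rewrite -complexiE oner_neq0.
have xE : biop_resolvent B 'i k = l^-1 *: gp.
  have xi : Astar (l^-1 *: gp) = 'i *: val (l^-1 *: gp).
    by rewrite AstarZ valZ Astar_gp !scalerA mulrC.
  rewrite -(biop_resolvent_diff _ _ _ _ i0 vv v0 BE xi) !dotpZl al_gp be_gp.
  by rewrite mulr1 mulr0 subr0 -kv'.
(* The impedance at i is the pairing of l^-1 g_+ with [k], and it equals a i. *)
have kp : k gp = - 'i * a%:C * l^*.
  move: imp; rewrite /impedance -/k -/B xE /channel_adj -/k /pairing hminusZr.
  rewrite rmorphM /= conjCK => /(congr1 (fun x => (l * x)^*)).
  rewrite mulrA divff // mul1r conjCK => ->.
  by rewrite !rmorphM /= conj_real conjCi; ring.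
have vp' : v gp = - 'i * (a%:C * (l * l^*)) by rewrite vk hminusZ kp; ring.
(* The jump relation [vp] becomes - 2i a |l|^2 = - i. *)
have ll : a%:C * (l * l^*) = 2^-1.
  move: vp; rewrite vp' !rmorphM rmorphN /= conjCi conj_real conjCK opprK => E.
  apply: (mulfI (_ : 2 * - 'i != 0)).
    by rewrite mulf_neq0 ?pnatr_eq0 // oppr_eq0 neq0Ci.
  rewrite [RHS]mulrAC divff ?pnatr_eq0 // mul1r -[RHS]E; ring.
have vphi : v = - ('i / 2) *: (phi + psi).
  apply: hminus_ext => f; rewrite (hminus_symop _ f vv) vm vp' ll hminusZ phipsiE.
  rewrite rmorphM rmorphN /= conjCi opprK fmorphV rmorph_nat.
  by move: (al f) (be f) => x y; rewrite rmorphD; ring.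
pose w := l^-1 * - ('i / 2).
have kw : k = w *: (phi + psi) by rewrite kv' vphi scalerA.
have ww : w * w^* = a%:C / 2.
  rewrite /w !rmorphM rmorphN rmorphM /= conjCi !fmorphV rmorph_nat /=.
  have a0 : a%:C != 0 :> R[i] by rewrite gt_eqF // (lt_trans ltr01 aC1).
  have -> : l^* = (2 * (a%:C * l))^-1.
    apply: (mulfI (mulf_neq0 a0 l0)); rewrite -mulrA ll invfM mulrCA divff ?mulr1 //.
    exact: mulf_neq0.
  transitivity (- 'i ^+ 2 * (a%:C / 2)); last by rewrite sqrCi opprK mul1r.
  by field; rewrite l0 a0.
clearbody w.
have stE : state Theta = canonical_state a.
  apply: biop_ext => f; rewrite sE BE vphi canonical_stateE -addrA; congr (_ + _).
  rewrite {2}kw !scalerA -scalerDl; congr (_ *: _).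
  rewrite /pairing kw hminusZ phipsiE; move: (al f) (be f) => x y.
  rewrite !rmorphM /= conjCK.
  have -> : 'i * (w^* * (x + y)) * w = 'i * (w * w^*) * (x + y) by ring.
  by rewrite ww; field.
split=> //; last by exists w.
(* The main operator lies in the quasi-kernel of its state-space operator. Conversely, [T] is
   one-dimensional over the domain of [A0], and [u] already supplies that dimension. *)
apply/seteqP; split=> [[x y] Txy|[x y] [f [/= <- <- fE]]].
  have [f fx fy] := T_Hplus _ _ Txy; rewrite -(quasi_kernel_canonical a) -stE.
  by exists f => //=; rewrite -fy; apply: sT; rewrite fx fy.
have uT : (1 - a%:C) * al u = (1 + a%:C) * be u.
  apply/ext_Hplus; rewrite -(quasi_kernel_canonical a) -stE.
  by exists u => //; exact: sT.
have bE (h : Hplus A0) : (1 - a%:C) * al h = (1 + a%:C) * be h ->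
    be h = (1 - a%:C) / (1 + a%:C) * al h.
  by move=> hE; rewrite mulrAC hE mulrAC divff ?mul1r // addaC_neq0.
have alu : al u != 0.
  by apply: contraNneq ab => alu; rewrite (bE _ uT) alu mulr0.
pose s := al f / al u.
have f0 : symop_dom (f - s *: u).
  apply: von_neumann; rewrite !dotpE; first by rewrite divfK // subrr.
  by rewrite (bE _ fE) (bE _ uT) /s; field; rewrite alu addaC_neq0.
have [_ Tlin _] := Top.
have := Tlin s _ _ Tu (TA _ f0).
have -> : s *: (val u, Astar u) + (val (f - s *: u), Astar (f - s *: u)) =
    (val f, Astar f).
  by rewrite !AstarE !valE; congr (_, _); rewrite addrC subrK.
by [].
Qed.

End CanonicalOperator.

End Deficiency.

Theorem theorem15 (R : realType) (H : hilbertType R) (A0 : symop H)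
  (gp gm : Hplus A0) (A : set (H * H)) (phi psi : Hminus A0) (g : H)
  (hdef : deficiency_indices A0 1 1)
  (hgp : defect A0 'i (val gp)) (hgm : defect A0 (- 'i) (val gm))
  (ngp : `|gp| = 1) (ngm : `|gm| = 1)
  (hA : self_adjoint_extension A0 A) (hgA : dom A (val gp + val gm))
  (hphi : riesz_berezansky phi = gp) (hpsi : riesz_berezansky psi = gm)
  (hg : defect A0 'i g) (ng : `|g| = 1) :
  (forall a : R, 1 < a ->
    exists Theta : Lsystem A0,
      [/\ state Theta = Astar_biop A0 -
            ('i / 2) *: rank1 ((1 - a%:C) *: phi - (1 + a%:C) *: psi)
                              (phi + psi),
          forall c : R[i],
            channel Theta c = c *: ((Num.sqrt (a / 2))%:C *: (phi + psi)),
          forall z : R[i], 0 < complex.Im z ->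
            impedance Theta z = a%:C * weyl_titchmarsh A g z,
          c_entropy Theta = (ln (a + 1) - ln (a - 1))%:E
        & dissipation_coefficient A0 (main Theta) = 4 * a / (1 + a) ^+ 2]) /\
  (forall a : R, 1 < a ->
    forall Theta : Lsystem A0,
      quasi_kernel (re_biop (state Theta)) = A ->
      (forall z : R[i], 0 < complex.Im z ->
        impedance Theta z = a%:C * weyl_titchmarsh A g z) ->
      c_entropy Theta = (ln (a + 1) - ln (a - 1))%:E /\
      dissipation_coefficient A0 (main Theta) = 4 * a / (1 + a) ^+ 2).
Proof.
have AE : A = ext gp gm 1 1 by apply: self_adjoint_extensionE.
split=> a a1.
  set Theta := canonical_system gp gm hdef hgp hgm ngp ngm phi psi hphi hpsi a a1.
  have stE : state Theta = canonical_state phi psi a by [].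
  have mE : main Theta = ext gp gm (1 - a%:C) (1 + a%:C) by [].
  have chE (c : R[i]) :
    channel Theta c = c *: ((Num.sqrt (a / 2))%:C *: (phi + psi)) by [].
  have wE : channel Theta 1 = (Num.sqrt (a / 2))%:C *: (phi + psi).
    by rewrite chE scale1r.
  have ww : (Num.sqrt (a / 2))%:C * (Num.sqrt (a / 2))%:C^* = a%:C / 2 :> R[i].
    by rewrite conj_real half_sqrtM.
  exists Theta; split=> //.
  - move=> z zpos; rewrite AE.
    exact: (impedance_weyl gp gm hdef hgp hgm ngp ngm phi psi hphi hpsi
      a Theta _ stE wE ww).
  - exact: (c_entropyE gp gm hdef hgp hgm ngp ngm phi psi hphi hpsi
      a a1 Theta _ stE wE ww).
  - exact: (dissipationE gp gm hdef hgp hgm ngp ngm a a1 Theta mE).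
move=> Theta qk imp.
have [||stE mE [w wE ww]] := state_from_impedance gp gm hdef hgp hgm ngp ngm
  phi psi hphi hpsi a a1 Theta.
- by rewrite qk.
- rewrite imp; last by rewrite -complexiE ltr01.
  by rewrite weyl_titchmarsh_i //; have [] := hA.
split; last exact: (dissipationE gp gm hdef hgp hgm ngp ngm a a1 Theta mE).
exact: (c_entropyE gp gm hdef hgp hgm ngp ngm phi psi hphi hpsi
  a a1 Theta _ stE wE ww).
Qed.
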